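(* The dynamic narrow DNF evaluation problem $\text{DNF}^{dy}$ is $\mathsf{NP}^{dy}$-complete; that is, $\text{DNF}^{dy}\in\mathsf{NP}^{dy}$, and if $\text{DNF}^{dy}\in\mathsf{P}^{dy}$ then every problem in $\mathsf{NP}^{dy}$ is in $\mathsf{P}^{dy}$.
   Context: Dynamic problems. A dynamic problem is a pair $\mathcal{D}=(\mathcal{P},\mathcal{G})$ where $\mathcal{P}$ maps bit-strings (instances) to answers ($\{0,1\}$ for decision problems) and $\mathcal{G}_n$ is a directed graph on $\{0,1\}^n$ whose edges $(I,I')$ are the allowed instance-updates; $\mathcal{D}_n$ is the restriction to $n$-bit instances; an instance-sequence of $\mathcal{D}_n$ is a directed path $(I_0,\dots,I_k)$ in $\mathcal{G}_n$. Standing assumption: instance-updates of $\mathcal{D}_n$ are encodable in $\Theta(\log n)$ bits. Bit-probe algorithms. An algorithm-family $\mathcal{A}=\{\mathcal{A}_n\}$: $\mathcal{A}_n$ operates on a bit array. At step $0$ it receives $I_0$ and sets its memory by an arbitrary function of $I_0$ (uncharged). At each step $t\ge1$ it receives $(I_{t-1},I_t)$ (possibly with extra input) and runs a fixed decision tree whose internal nodes read a memory bit (branching on it) or write a memory bit; output is read from a designated region. Update time = decision tree depth; space = number of memory bits. $\mathcal{A}$ solves decision problem $\mathcal{D}$ if for every $n$ and every instance-sequence of $\mathcal{D}_n$ of length $\mathrm{poly}(n)$ the output at every step $t$ is $\mathcal{D}(I_t)$. $\mathsf{P}^{dy}$: decision problems solvable with update time $O(\mathrm{polylog}\,n)$ and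 space $O(\mathrm{poly}\,n)$. Verifiers and $\mathsf{NP}^{dy}$. A verifier-family $\mathcal{V}$: at step $0$, $\mathcal{V}_n$ gets $I_0$ and outputs $(x_0,y_0)$; at step $t\ge1$ it gets $((I_{t-1},I_t),\pi_t)$, $\pi_t\in\{0,1\}^{\mathrm{polylog}\,n}$, and outputs $(x_t,y_t)$, $x_t\in\{0,1\}$, $y_t\in\{0,1\}^{\mathrm{polylog}\,n}$ read as an integer reward. A proof-sequence is reward-maximizing if each $\pi_t$ maximizes $y_t$ given the history. $\mathcal{D}\in\mathsf{NP}^{dy}$ iff a verifier-family with update time $O(\mathrm{polylog}\,n)$ and space $O(\mathrm{poly}\,n)$ satisfies for every $n$ and instance-sequence: (1) for every proof-sequence, $x_t=0$ whenever $\mathcal{D}(I_t)=0$; (2) for reward-maximizing proof-sequences, $x_t=1$ whenever $\mathcal{D}(I_t)=1$. $\text{DNF}^{dy}$: an instance consists of a DNF formula $F=C_1\vee\dots\vee C_m$ over variables $x_1,\dots,x_n$, each clause a conjunction of at most $w=\mathrm{polylog}(m)$ literals, together with an assignment $\phi$ of the variables; an update $(i,b)$ sets $\phi(x_i)=b$; the answer is whether $F(\phi)=1$. *)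

(* Defs.v *)
From mathcomp Require Import all_boot.
Set Implicit Arguments.
Unset Strict Implicit.
Unset Printing Implicit Defensive.

(* f is O(poly n), resp. O(polylog n), iff f is pointwise at most [poly c],
   resp. [polylog c], for some c; the additive c absorbs the finitely many
   small n, where n or log n may be 0 or 1. *)
Definition poly (c n : nat) : nat := n ^ c + c.
Definition polylog (c n : nat) : nat := c * up_log 2 n ^ c + c.

Definition poly_bounded (f : nat -> nat) : Prop :=
  exists c, forall n, f n <= poly c n.
Definition polylog_bounded (f : nat -> nat) : Prop :=
  exists c, forall n, f n <= polylog c n.
Definition Theta_log (f : nat -> nat) : Prop :=
  exists c, forall n, 1 < n -> f n <= c * up_log 2 n /\ up_log 2 n <= c * f n.

(* Least significant bit first. *)
Definition nat_of_bits (s : bitseq) : nat :=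
  foldr (fun (b : bool) k => b + k.*2) 0 s.

(* [upd n I u = Some J] means that the codeword u encodes the instance-update
   (I, J) relative to I. An algorithm holding I is handed u, not I and J: these
   have n bits each, and a decision tree chosen in terms of J could simply
   output [answer J]. The codewords are part of the problem, since letting each
   algorithm choose its own would let a codeword carry the answer. *)
Record dynamic_problem := DynamicProblem {
  answer : bitseq -> bool;
  edge : forall n, n.-tuple bool -> n.-tuple bool -> Prop;
  upd_len : nat -> nat;
  upd : forall n, n.-tuple bool -> (upd_len n).-tuple bool ->
          option (n.-tuple bool);
  edgeP : forall n (I J : n.-tuple bool),
          edge I J <-> exists u, upd I u = Some J;
  upd_lenP : Theta_log upd_len
}.

(* (I, I_1, ..., I_k) is a directed path of the update graph, given with a
   codeword for each of its edges: s = [:: (u_1, I_1); ...; (u_k, I_k)]. *)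
Fixpoint instance_sequence (D : dynamic_problem) n (I : n.-tuple bool)
    (s : seq ((upd_len D n).-tuple bool * n.-tuple bool)) : Prop :=
  if s is (u, J) :: s' then upd I u = Some J /\ instance_sequence J s' else True.

Definition memory (S : nat) := {ffun 'I_S -> bool}.

Inductive dtree (S : nat) : Type :=
| Stop
| Read (a : 'I_S) (t0 t1 : dtree S)
| Write (a : 'I_S) (b : bool) (t : dtree S).

Fixpoint depth S (t : dtree S) : nat :=
  match t with
  | Stop => 0
  | Read _ t0 t1 => (maxn (depth t0) (depth t1)).+1
  | Write _ _ t' => (depth t').+1
  end.

Fixpoint exec S (t : dtree S) (m : memory S) : memory S :=
  match t with
  | Stop => m
  | Read a t0 t1 => exec (if m a then t1 else t0) m
  | Write a b t' => exec t' [ffun a' => if a' == a then b else m a']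
  end.

(* [in_addr] and [out_addr] designate the memory regions where the input of a
   step is placed and where its output is read. *)
Record machine (n ilen olen : nat) := Machine {
  space : nat;
  in_addr : 'I_ilen -> 'I_space;
  in_addr_inj : injective in_addr;
  out_addr : 'I_olen -> 'I_space;
  init : n.-tuple bool -> memory space;
  tree : dtree space
}.

Definition load n ilen olen (M : machine n ilen olen) (x : ilen.-tuple bool)
    (m : memory (space M)) : memory (space M) :=
  [ffun a => if [pick i | in_addr M i == a] is Some i then tnth x i else m a].

Definition step n ilen olen (M : machine n ilen olen)
    (m : memory (space M)) (x : ilen.-tuple bool) : memory (space M) :=
  exec (tree M) (load x m).

Definition output n ilen olen (M : machine n ilen olen)
    (m : memory (space M)) : olen.-tuple bool :=
  [tuple m (out_addr M i) | i < olen].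

Definition output_after n ilen olen (M : machine n ilen olen)
    (I : n.-tuple bool) (xs : seq (ilen.-tuple bool)) : olen.-tuple bool :=
  output (foldl (@step n ilen olen M) (init M I) xs).

Definition algorithm_family (D : dynamic_problem) :=
  forall n, machine n (upd_len D n) 1.

Definition solves (D : dynamic_problem) (A : algorithm_family D) : Prop :=
  forall c n (I0 : n.-tuple bool) s,
    instance_sequence I0 s -> size s <= poly c n ->
  forall t, t <= size s ->
    thead (output_after (A n) I0 (take t (unzip1 s)))
      = answer D (nth I0 (I0 :: unzip2 s) t).

Definition Pdy (D : dynamic_problem) : Prop :=
  exists A : algorithm_family D,
    [/\ polylog_bounded (fun n => depth (tree (A n))),
        poly_bounded (fun n => space (A n))
      & solves A].

(* plen n and rlen n are the bit-lengths of the proofs and of the rewards; the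
   output of a step is x_t followed by the bits of y_t. *)
Definition verifier_family (D : dynamic_problem) (plen rlen : nat -> nat) :=
  forall n, machine n (upd_len D n + plen n) (rlen n).+1.

Section Verifier.
Variables (D : dynamic_problem) (plen rlen : nat -> nat).
Variable V : verifier_family D plen rlen.
Variables (n : nat) (I0 : n.-tuple bool).
Variable us : seq ((upd_len D n).-tuple bool).

(* The output of step [size ps], on the first [size ps] updates of us. *)
Definition verifier_output (ps : seq ((plen n).-tuple bool)) :=
  output_after (V n) I0 [seq cat_tuple up.1 up.2 | up <- zip us ps].

Definition verdict ps : bool := thead (verifier_output ps).
Definition reward ps : nat := nat_of_bits (behead (verifier_output ps)).

Definition reward_maximizing (ps : seq ((plen n).-tuple bool)) : Prop :=
  forall t, t < size ps -> forall p : (plen n).-tuple bool,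
    reward (rcons (take t ps) p) <= reward (take t.+1 ps).

End Verifier.

Definition NPdy (D : dynamic_problem) : Prop :=
  exists (plen rlen : nat -> nat) (V : verifier_family D plen rlen),
    [/\ polylog_bounded plen, polylog_bounded rlen,
        polylog_bounded (fun n => depth (tree (V n))),
        poly_bounded (fun n => space (V n))
      & forall n (I0 : n.-tuple bool) s, instance_sequence I0 s ->
        forall ps : seq ((plen n).-tuple bool), size ps = size s ->
          (forall t, t <= size s ->
             answer D (nth I0 (I0 :: unzip2 s) t) = false ->
             verdict V I0 (unzip1 s) (take t ps) = false)
          /\
          (reward_maximizing V I0 (unzip1 s) ps ->
           forall t, t <= size s ->
             answer D (nth I0 (I0 :: unzip2 s) t) = true ->
             verdict V I0 (unzip1 s) (take t ps) = true)].

(* A clause is a set of literals; (i, true) stands for x_i, (i, false) for its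
   negation. *)
Record dnf_instance := DnfInstance {
  nvars : nat;
  formula : seq {set 'I_nvars * bool};
  assignment : {ffun 'I_nvars -> bool}
}.

Definition dnf_eval (X : dnf_instance) : bool :=
  has (fun C : {set _} => [forall l in C, assignment X l.1 == l.2]) (formula X).

Definition narrow (c : nat) (X : dnf_instance) : bool :=
  all (fun C : {set _} => #|C| <= polylog c (size (formula X))) (formula X).

Definition set_var (X : dnf_instance) (i : 'I_(nvars X)) (b : bool) :=
  DnfInstance (formula X) [ffun j => if j == i then b else assignment X j].

(* 1^n 0 1^m 0, the n bits of the assignment, then the m by 2n incidence matrix
   of clauses and literals. Its length is polynomially related to n + m, hence
   to the length of any other usual encoding. *)
Definition dnf_encode (X : dnf_instance) : bitseq :=
  nseq (nvars X) true ++ false :: nseq (size (formula X)) true ++ false ::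
  codom (assignment X) ++
  flatten [seq codom (mem C) | C : {set 'I_(nvars X) * bool} <- formula X].

Definition dnf_decode (s : bitseq) : option dnf_instance :=
  let n := index false s in
  let s1 := drop n.+1 s in
  let m := index false s1 in
  let s2 := drop m.+1 s1 in
  if size s == n.+1 + m.+1 + n + m * (n * 2) then
    Some (DnfInstance
      [seq [set l : 'I_n * bool | nth false r (enum_rank l)]
         | r <- reshape (nseq m (n * 2)) (drop n s2)]
      [ffun i : 'I_n => nth false s2 i])
  else None.

Lemma dnf_encodeK : pcancel dnf_encode dnf_decode.
Proof.
case=> n F phi; rewrite /dnf_decode /dnf_encode /=.
have idx k s : index false (nseq k true ++ false :: s) = k.
  by elim: k => //= k ->.
have drp k s : drop k.+1 (nseq k true ++ false :: s) = s.
  by elim: k => [|k IH] //=; rewrite drop0.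
rewrite idx drp idx drp.
have shE : shape [seq codom (mem C) | C : {set 'I_n * bool} <- F]
    = nseq (size F) (n * 2).
  elim: F => //= C F ->.
  by rewrite size_codom card_prod card_ord card_bool.
have -> : size (nseq n true ++ false :: nseq (size F) true ++ false ::
    codom phi ++ flatten [seq codom (mem C) | C : {set 'I_n * bool} <- F])
    = n.+1 + (size F).+1 + n + size F * (n * 2).
  rewrite !(size_cat, size_nseq) /= !(size_cat, size_nseq) /= size_cat.
  rewrite size_codom card_ord size_flatten shE sumn_nseq.
  by rewrite (mulnC (n * 2)) -!addnA !addSnnS.
rewrite eqxx; congr (Some (DnfInstance _ _)); last first.
  apply/ffunP=> i; rewrite ffunE nth_cat size_codom card_ord ltn_ord.
  have ic : i < #|'I_n| by rewrite card_ord.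
  rewrite (@nth_codom _ _ false phi (Ordinal ic)); congr (phi _).
  by apply: val_inj; rewrite enum_val_ord.
rewrite drop_size_cat ?size_codom ?card_ord // -shE flattenK -map_comp.
rewrite -[RHS]map_id; apply: eq_map => C /=.
by apply/setP=> l; rewrite inE nth_codom enum_rankK.
Qed.

Lemma dnf_decodeK : ocancel dnf_decode dnf_encode.
Proof.
move=> s; rewrite /dnf_decode /dnf_encode.
set n := index false s; set s1 := drop n.+1 s; set m := index false s1.
set s2 := drop m.+1 s1; case: eqP => //= sz.
have idx r : index false r < size r ->
    r = nseq (index false r) true ++ false :: drop (index false r).+1 r.
  by elim: r => [|[] r IH] //= h; rewrite ?drop0 // -IH.
have ns : n < size s by rewrite sz -!addnA ltn_addr.
have sz1 : size s1 = m.+1 + n + m * (n * 2).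
  by rewrite size_drop sz -!addnA addKn.
have ms : m < size s1 by rewrite sz1 -!addnA ltn_addr.
have sz2 : size s2 = n + m * (n * 2) by rewrite size_drop sz1 -!addnA addKn.
have szd : size (drop n s2) = sumn (nseq m (n * 2)).
  by rewrite size_drop sz2 addKn sumn_nseq mulnC.
rewrite size_map size_reshape size_nseq.
rewrite [in RHS](idx s ns) -/n -/s1 [in RHS](idx s1 ms) -/m -/s2.
congr (_ ++ _ :: _ ++ _ :: _); rewrite -[RHS](cat_take_drop n); congr (_ ++ _).
  apply: (@eq_from_nth _ false).
    by rewrite size_codom card_ord size_takel // sz2 leq_addr.
  rewrite size_codom => i ic; rewrite (@nth_codom _ _ false _ (Ordinal ic)).
  have iN : i < n by move: ic; rewrite card_ord.
  by rewrite ffunE enum_val_ord nth_take.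
rewrite -map_comp -[RHS](reshapeKr (sh := nseq m (n * 2))) ?szd //.
congr flatten; rewrite -[RHS]map_id; apply/eq_in_map => r rin /=.
have szr : size r = #|{: 'I_n * bool}|.
  rewrite card_prod card_ord card_bool.
  have : size r \in shape (reshape (nseq m (n * 2)) (drop n s2)) by exact: map_f.
  by rewrite reshapeKl ?szd // mem_nseq => /andP[_ /eqP].
apply: (@eq_from_nth _ false); first by rewrite size_codom szr.
rewrite size_codom => i ic; rewrite (@nth_codom _ _ false _ (Ordinal ic)).
by rewrite /= inE; congr nth; exact: (congr1 val (enum_valK (Ordinal ic))).
Qed.

Lemma nat_of_bits_surj k i : i < 2 ^ k ->
  exists u : k.-tuple bool, nat_of_bits u = i.
Proof.
elim: k i => [|k IH] i; first by case: i => // _; exists [tuple].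
rewrite expnS mul2n => lt_i.
have [|u uE] := IH i./2; first by rewrite ltn_half_double.
by exists [tuple of odd i :: u]; rewrite /= uE odd_double_half.
Qed.

Lemma nvars_encode X : nvars X <= size (dnf_encode X).
Proof. by rewrite size_cat size_nseq leq_addr. Qed.

Definition dnf_answer (c : nat) (s : bitseq) : bool :=
  if dnf_decode s is Some X then narrow c X && dnf_eval X else false.

Definition dnf_edge (c n : nat) (I J : n.-tuple bool) : Prop :=
  exists X (i : 'I_(nvars X)) b,
    [/\ narrow c X, I = dnf_encode X :> bitseq
      & J = dnf_encode (set_var i b) :> bitseq].

(* The update (i, b) is encoded as b followed by the bits of i. *)
Definition dnf_upd_len (n : nat) : nat := (up_log 2 n).+1.

Definition dnf_upd (c n : nat) (I : n.-tuple bool)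
    (u : (dnf_upd_len n).-tuple bool) : option (n.-tuple bool) :=
  if dnf_decode I is Some X then
    if narrow c X then
      if (insub (nat_of_bits (behead u)) : option 'I_(nvars X)) is Some i then
        insub (dnf_encode (set_var i (thead u)))
      else None
    else None
  else None.

Lemma dnf_edgeP c n (I J : n.-tuple bool) :
  dnf_edge c I J <-> exists u, dnf_upd c I u = Some J.
Proof.
split=> [[X [i [b [nX IE JE]]]] | [u]].
  have lt_i : i < 2 ^ up_log 2 n.
    apply: leq_trans (up_logP n (isT : 1 < 2)).
    by rewrite -(size_tuple I) IE (leq_trans (ltn_ord i)) ?nvars_encode.
  have [u uE] := nat_of_bits_surj lt_i.
  exists [tuple of b :: u]; rewrite /dnf_upd IE dnf_encodeK nX /= uE.
  by rewrite valK theadE -JE valK.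
rewrite /dnf_upd; have := dnf_decodeK I; case: dnf_decode => //= X XE.
case: ifP => // nX; case: insubP => // i _ _.
case: insubP => // J' _ JE [<-].
by exists X, i, (thead u); split.
Qed.

Lemma dnf_upd_lenP : Theta_log dnf_upd_len.
Proof.
exists 2 => n n_gt1; rewrite /dnf_upd_len; split; last first.
  by rewrite mulnS mul2n -addnn addnA leq_addl.
by rewrite mul2n -addnn -addn1 leq_add2l up_log_gt0.
Qed.

(* The width bound is polylog(m) = c (log m)^c + c. Bit-strings that encode no
   narrow DNF instance are isolated vertices of the update graph, with answer
   0. *)
Definition DNFdy (c : nat) : dynamic_problem :=
  {| answer := dnf_answer c; edge := @dnf_edge c; upd_len := dnf_upd_len;
     upd := @dnf_upd c; edgeP := @dnf_edgeP c; upd_lenP := dnf_upd_lenP |}.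

(* Main.v *)
(* Hardness. Let V be a verifier for D with memory m. Whether some proof p gives
   the number formed by the reward (high-order bits) and p (low-order bits) a
   value at least v depends, once p is fixed, on few bits of m and v, so it is
   a narrow DNF formula in the bits of m and v. A data structure for this
   formula lets one find a reward-maximizing proof by binary search on v, and
   then execute V on it while passing each change of m on to the data structure.

   The formula has quasi-polynomially many clauses, so the DNF algorithm may
   use quasi-polynomial space. But the formula and the all-false assignment
   depend only on n, hence the memory in which the DNF algorithm starts from them
   can be hard-wired into the decision tree, and only the deviations from it need
   to be stored, in a binary trie. The number of deviations is kept
   polynomial by keeping two copies: while one answers the queries, the other
   is rebuilt from scratch, one variable per update, and then they are swapped.

   Membership. The proof is the index of a clause; the verdict and the reward
   tell whether this clause is satisfied. *)

Require Import Defs.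
From mathcomp Require Import all_boot zify.
Set Implicit Arguments.
Unset Strict Implicit.
Unset Printing Implicit Defensive.

(** * Asymptotic bounds *)

(** The base is at least 2, so one power absorbs constant factors and summands, and closure under
    sums and products reduces to adding exponents. For [b] the identity this is polynomial growth,
    for [b] equal to [up_log 2] polylogarithmic growth. *)
Definition bounded_by (b f : nat -> nat) : Prop :=
  exists k, forall n, f n <= (b n).+2 ^ k.

Lemma bounded_le b f g : (forall n, f n <= g n) -> bounded_by b g -> bounded_by b f.
Proof. by move=> le_fg [k gk]; exists k => n; apply: leq_trans (gk n). Qed.

Lemma bounded_const b k : bounded_by b (fun _ => k).
Proof.
exists k => n; apply: leq_trans (ltnW (ltn_expl k (isT : 1 < 2))) _.
by case: k => // k; rewrite leq_exp2r.
Qed.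

Lemma bounded_base b : bounded_by b b.
Proof. by exists 1 => n; rewrite expn1 ltnW. Qed.

Lemma bounded_mul b f g :
  bounded_by b f -> bounded_by b g -> bounded_by b (fun n => f n * g n).
Proof.
by move=> [k fk] [l gl]; exists (k + l) => n; rewrite expnD leq_mul.
Qed.

Lemma bounded_add b f g :
  bounded_by b f -> bounded_by b g -> bounded_by b (fun n => f n + g n).
Proof.
move=> [k fk] [l gl]; exists (k + l).+1 => n; rewrite expnS.
apply: (@leq_trans (2 * (b n).+2 ^ (k + l))); last by rewrite leq_mul2r orbC.
rewrite mul2n -addnn leq_add //.
  by apply: leq_trans (fk n) _; rewrite leq_exp2l ?leq_addr.
by apply: leq_trans (gl n) _; rewrite leq_exp2l ?leq_addl.
Qed.

Lemma bounded_succ b f : bounded_by b f -> bounded_by b (fun n => (f n).+1).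
Proof.
move=> fb; apply: (bounded_le (g := fun n => f n + 1)); last first.
  exact: bounded_add fb (bounded_const _ _).
by move=> n; rewrite addn1.
Qed.

Lemma bounded_exp b f k : bounded_by b f -> bounded_by b (fun n => f n ^ k).
Proof.
by move=> [l fl]; exists (l * k) => n; rewrite expnM; case: k => // k; rewrite leq_exp2r.
Qed.

(** Needed for quasi-polynomial sizes [N n]: when their logarithm is polylogarithmic in [n], so is
    whatever is polylogarithmic in [N n]. *)
Lemma bounded_comp b b' f N :
  bounded_by b f -> bounded_by b' (fun n => b (N n)) -> bounded_by b' (fun n => f (N n)).
Proof.
move=> [k fk] bN; apply: bounded_le (fun n => fk (N n)) _.
by apply: bounded_exp; do 2! apply: bounded_succ.
Qed.

(** For [x] at least 2, [x.+2 <= x ^ 2]; for smaller [x] the constant suffices. The exponent is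
    padded with [3 ^ k] because [poly] and [polylog] use one parameter both as exponent and as
    additive constant. *)
Lemma expn_succ2_le k x : x.+2 ^ k <= x ^ (2 * k + 3 ^ k) + 3 ^ k.
Proof.
have [x_le1|x_gt1] := leqP x 1.
  apply: leq_trans (leq_addl _ _).
  by case: k => // k; rewrite leq_exp2r.
apply: leq_trans (leq_addr _ _); apply: (@leq_trans (x ^ (2 * k))).
  by rewrite expnM; case: k => // k; rewrite leq_exp2r // expnS expn1; nia.
by rewrite leq_exp2l // leq_addr.
Qed.

Lemma poly_boundedP f : poly_bounded f <-> bounded_by id f.
Proof.
split=> [[k fk]|[k fk]].
  apply: bounded_le fk _; apply: bounded_add (bounded_const _ _).
  exact/bounded_exp/bounded_base.
exists (2 * k + 3 ^ k) => n; apply: leq_trans (fk n) _.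
by apply: leq_trans (expn_succ2_le k n) _; rewrite leq_add2l leq_addl.
Qed.

Lemma polylog_boundedP f : polylog_bounded f <-> bounded_by (up_log 2) f.
Proof.
split=> [[k fk]|[k fk]].
  apply: bounded_le fk _; apply: bounded_add (bounded_const _ _).
  by apply: bounded_mul (bounded_const _ _) _; apply/bounded_exp/bounded_base.
exists (2 * k + 3 ^ k) => n; apply: leq_trans (fk n) _.
apply: leq_trans (expn_succ2_le k _) _; apply: leq_add; last exact: leq_addl.
by rewrite leq_pmull // addn_gt0 expn_gt0 orbT.
Qed.

Lemma up_log_leq n : up_log 2 n <= n.
Proof. by apply: up_log_min => //; apply/ltnW/ltn_expl. Qed.

Lemma bounded_polylog f : bounded_by (up_log 2) f -> bounded_by id f.
Proof.
case=> k fk; exists k => n; apply: leq_trans (fk n) _.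
by case: k {fk} => // k; rewrite leq_exp2r // !ltnS up_log_leq.
Qed.

Lemma up_log_add m n : up_log 2 (m + n) <= up_log 2 m + up_log 2 n + 1.
Proof.
apply: up_log_min => //; rewrite addn1 expnS expnD mul2n -addnn.
have [hm hn] := (up_logP m (isT : 1 < 2), up_logP n (isT : 1 < 2)).
have [pm pn] : 0 < 2 ^ up_log 2 m /\ 0 < 2 ^ up_log 2 n by rewrite !expn_gt0.
by apply: leq_add; [apply: leq_trans hm _; rewrite leq_pmulr|
                    apply: leq_trans hn _; rewrite leq_pmull].
Qed.

Lemma up_log_exp m k : up_log 2 (m ^ k) <= k * up_log 2 m.
Proof.
apply: up_log_min => //; rewrite mulnC expnM.
by case: k => // k; rewrite leq_exp2r // up_logP.
Qed.

Lemma bounded_up_log_poly f :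
  bounded_by id f -> bounded_by (up_log 2) (fun n => up_log 2 (f n)).
Proof.
case=> k fk; apply: (bounded_le (g := fun n => k * (up_log 2 n + 1 + 1))).
  move=> n; apply: leq_trans (leq_up_log 2 (fk n)) _.
  apply: leq_trans (up_log_exp _ _) _; rewrite leq_mul2l orbC.
  by have := up_log_add n 2; rewrite addn2 /= => ->.
apply: bounded_mul (bounded_const _ _) _.
by do 2! apply: bounded_add (bounded_const _ _); apply: bounded_base.
Qed.

Lemma Theta_log_bounded f : Theta_log f -> bounded_by (up_log 2) f.
Proof.
case=> k fk; apply: (bounded_le (g := fun n => k * up_log 2 n + (f 0 + f 1))).
  case=> [|[|n]]; [by rewrite addnCA leq_addr|by rewrite addnA leq_addl|].
  by have [h _] := fk n.+2 isT; rewrite (leq_trans h) ?leq_addr.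
apply: bounded_add (bounded_const _ _).
by apply: bounded_mul (bounded_const _ _) (bounded_base _).
Qed.

(** * Bit strings *)

Fixpoint bits (k i : nat) : bitseq :=
  if k is k'.+1 then odd i :: bits k' i./2 else [::].

Lemma size_bits k i : size (bits k i) = k.
Proof. by elim: k i => //= k IH i; rewrite IH. Qed.

Lemma bitsK k i : i < 2 ^ k -> nat_of_bits (bits k i) = i.
Proof.
elim: k i => [|k IH] i /=; first by case: i.
by rewrite expnS mul2n => lt_i; rewrite IH ?odd_double_half ?ltn_half_double.
Qed.

Lemma nat_of_bits_inj s t : size s = size t -> nat_of_bits s = nat_of_bits t -> s = t.
Proof.
elim: s t => [|x s IH] [|y t] //= [sz] E.
have xy : x = y.
  by have := congr1 odd E; rewrite !oddD !odd_double !addbF !oddb.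
congr (_ :: _) => //; apply: IH => //.
by move: E; rewrite xy => /addnI /double_inj.
Qed.

Lemma nat_of_bits_lt s : nat_of_bits s < 2 ^ size s.
Proof. by elim: s => //= x s IH; rewrite expnS; lia. Qed.

Lemma nat_of_bits_cat s t :
  nat_of_bits (s ++ t) = nat_of_bits s + 2 ^ size s * nat_of_bits t.
Proof. by elim: s => [|x s IH] /=; rewrite ?mul1n // IH expnS; lia. Qed.

(** * Decision trees *)

Definition write S (m : memory S) (ab : 'I_S * bool) : memory S :=
  [ffun a => if a == ab.1 then ab.2 else m a].

Fixpoint read_all S (s : seq 'I_S) (K : bitseq -> dtree S) : dtree S :=
  if s is a :: s' then
    Read a (read_all s' (fun r => K (false :: r))) (read_all s' (fun r => K (true :: r)))
  else K [::].

Definition write_all S (s : seq ('I_S * bool)) (t : dtree S) : dtree S :=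
  foldr (fun ab t' => Write ab.1 ab.2 t') t s.

Lemma exec_read_all S (s : seq 'I_S) K m :
  exec (read_all s K) m = exec (K [seq m a | a <- s]) m.
Proof. by elim: s K => //= a s IH K; case: (m a); rewrite IH. Qed.

Lemma depth_read_all S (s : seq 'I_S) K d :
  (forall r, depth (K r) <= d) -> depth (read_all s K) <= size s + d.
Proof.
elim: s K => [|a s IH] K Kd //=.
by rewrite addSn ltnS geq_max !IH.
Qed.

Lemma exec_write_all S (s : seq ('I_S * bool)) t m :
  exec (write_all s t) m = exec t (foldl (@write S) m s).
Proof. by elim: s m => //= ab s IH m; rewrite IH. Qed.

Lemma depth_write_all S (s : seq ('I_S * bool)) t :
  depth (write_all s t) = size s + depth t.
Proof. by elim: s => //= ab s ->. Qed.

Lemma foldl_write_notin S (s : seq ('I_S * bool)) m a :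
  a \notin unzip1 s -> foldl (@write S) m s a = m a.
Proof.
elim: s m => //= ab s IH m; rewrite inE negb_or => /andP[na ns].
by rewrite IH // ffunE (negPf na).
Qed.

Lemma foldl_write_in S (T : eqType) (s : seq T) (f : T -> 'I_S) (g : T -> bool) m x :
  {in s &, injective f} -> x \in s ->
  foldl (@write S) m [seq (f y, g y) | y <- s] (f x) = g x.
Proof.
elim: s m => //= y s IH m finj; rewrite inE.
have fs : {in s &, injective f}.
  by move=> u v us vs; apply: finj; rewrite inE ?us ?vs orbT.
have [xs _|xs /orP[/eqP xy|//]] := boolP (x \in s); first exact: IH.
rewrite -xy foldl_write_notin; first by rewrite ffunE eqxx.
apply/negP; rewrite /unzip1 -map_comp => /mapP[z zs /finj E].
by move: xs; rewrite E ?zs // inE -?xy ?eqxx ?zs ?orbT.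
Qed.

(** * Machine steps as plain decision trees *)

Section Machines.
Variables (n ilen olen : nat) (M : machine n ilen olen).

Definition input_writes (x : ilen.-tuple bool) : seq ('I_(space M) * bool) :=
  [seq (in_addr M i, tnth x i) | i <- enum 'I_ilen].

(** Turning the free loading of the input into explicit writes makes a step on a fixed input a
    decision tree, which another machine can simulate. *)
Definition step_tree (x : ilen.-tuple bool) : dtree (space M) :=
  write_all (input_writes x) (tree M).

Lemma load_write x m : load x m = foldl (@write _) m (input_writes x).
Proof.
apply/ffunP=> a; rewrite ffunE; case: pickP => [i /eqP <-|noi].
  rewrite (foldl_write_in (f := in_addr M)) ?mem_enum //.
  by move=> i1 i2 _ _; apply: in_addr_inj.
rewrite foldl_write_notin //; apply/negP; rewrite /unzip1 -map_comp => /mapP[i _ ai].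
by have := noi i; rewrite ai eqxx.
Qed.

Lemma step_treeE m x : step m x = exec (step_tree x) m.
Proof. by rewrite /step load_write exec_write_all. Qed.

Lemma size_input_writes x : size (input_writes x) = ilen.
Proof. by rewrite size_map size_enum_ord. Qed.

Lemma depth_step_tree x : depth (step_tree x) = ilen + depth (tree M).
Proof. by rewrite depth_write_all size_input_writes. Qed.

End Machines.

(** * Word programs *)

Section Programs.
Variables J W : finType.

(** Only accesses to memory words are recorded: computation on words already read is free, since a
    decision tree can hard-wire it. *)
Inductive prog (X : Type) : Type :=
| Ret of X
| Get of J & (W -> prog X)
| Put of J & W & prog X.

Arguments Ret {X}.

Definition put (m : {ffun J -> W}) j w : {ffun J -> W} :=
  [ffun j' => if j' == j then w else m j'].

Fixpoint run X (p : prog X) (m : {ffun J -> W}) : X * {ffun J -> W} :=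
  match p with
  | Ret x => (x, m)
  | Get j f => run (f (m j)) m
  | Put j w p' => run p' (put m j w)
  end.

Fixpoint bind X Y (p : prog X) (f : X -> prog Y) : prog Y :=
  match p with
  | Ret x => f x
  | Get j g => Get j (fun w => bind (g w) f)
  | Put j w p' => Put j w (bind p' f)
  end.

Lemma run_bind X Y (p : prog X) (f : X -> prog Y) m :
  run (bind p f) m = run (f (run p m).1) (run p m).2.
Proof. by elim: p m => //= j g IH m. Qed.

(** A predicate for upper bounds avoids a maximum over all words that a [Get] may return. *)
Fixpoint costs X (p : prog X) (k : nat) : Prop :=
  match p, k with
  | Ret _, _ => True
  | Get _ f, k'.+1 => forall w, costs (f w) k'
  | Put _ _ p', k'.+1 => costs p' k'
  | _, 0 => False
  end.

Lemma costs_le X (p : prog X) k l : k <= l -> costs p k -> costs p l.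
Proof.
elim: p k l => [x|j f IH|j w p IH] [|k] [|l] //=.
  by rewrite ltnS => kl fk w; apply: IH kl _.
by rewrite ltnS => /IH.
Qed.

Lemma costs_bind X Y (p : prog X) (f : X -> prog Y) k l :
  costs p k -> (forall x, costs (f x) l) -> costs (bind p f) (k + l).
Proof.
elim: p k => [x|j g IH|j w p IH] k //=.
- by move=> _ fl; apply: costs_le (fl x); apply: leq_addl.
- by case: k => // k gk fl w; apply: IH.
- by case: k => // k pk fl; apply: IH.
Qed.

End Programs.
Arguments Ret {J W X}.
Arguments bind : simpl never.
Notation "'let!' x := p 'in' q" := (bind p (fun x => q))
  (at level 200, x name, p at level 100, right associativity).

Record word_machine (n ilen olen : nat) := WordMachine {
  cell : finType;
  word : finType;
  word0 : word;
  init_out : n.-tuple bool -> olen.-tuple bool;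
  init_mem : n.-tuple bool -> {ffun cell -> word};
  step_prog : ilen.-tuple bool -> prog cell word (olen.-tuple bool)
}.

Definition word_run n ilen olen (M : word_machine n ilen olen)
    (I : n.-tuple bool) (xs : seq (ilen.-tuple bool)) :=
  foldl (fun st x => run (step_prog M x) st.2) (init_out M I, init_mem M I) xs.

(** * Compilation of word programs into bit-probe machines *)

Section Compile.
Variables (n ilen olen : nat) (M : word_machine n ilen olen).
Local Notation J := (cell M).
Local Notation W := (word M).

Definition wlen : nat := up_log 2 #|word M|.
Definition bit_cell : finType := ('I_ilen + 'I_olen + cell M * 'I_wlen)%type.
Local Notation S := #|{: bit_cell}|.
Definition bit_addr (a : bit_cell) : 'I_S := enum_rank a.

Definition encode (w : W) : bitseq := bits wlen (enum_rank w).
Definition decode (s : bitseq) : W := nth (word0 M) (enum W) (nat_of_bits s).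

Lemma encodeK : cancel encode decode.
Proof.
move=> w; rewrite /decode /encode bitsK.
  by rewrite -[RHS](enum_rankK w) (enum_val_nth (word0 M)).
exact: leq_trans (ltn_ord _) (up_logP _ _).
Qed.

Definition word_addrs (j : J) : seq 'I_S :=
  [seq bit_addr (inr (j, i)) | i <- enum 'I_wlen].

Definition word_writes (j : J) (w : W) : seq ('I_S * bool) :=
  [seq (bit_addr (inr (j, i)), nth false (encode w) i) | i <- enum 'I_wlen].

Definition out_writes (o : olen.-tuple bool) : seq ('I_S * bool) :=
  [seq (bit_addr (inl (inr i)), tnth o i) | i <- enum 'I_olen].

Fixpoint compile (p : prog J W (olen.-tuple bool)) : dtree S :=
  match p with
  | Ret o => write_all (out_writes o) (Stop S)
  | Get j f => read_all (word_addrs j) (fun s => compile (f (decode s)))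
  | Put j w p' => write_all (word_writes j w) (compile p')
  end.

Lemma depth_compile p k : costs p k -> depth (compile p) <= k * wlen + olen.
Proof.
elim: p k => [o|j f IH|j w p IH] k /=.
- by rewrite depth_write_all size_map size_enum_ord addn0 leq_addl.
- case: k => // k fk; rewrite mulSn -addnA.
  apply: leq_trans (depth_read_all _ (fun r => IH _ _ (fk _))) _.
  by rewrite size_map size_enum_ord.
- case: k => // k pk; rewrite mulSn -addnA depth_write_all size_map size_enum_ord.
  by rewrite leq_add2l IH.
Qed.

(** The input and output bits are left unconstrained, so loading an input or writing an output
    preserves this relation. *)
Definition represents (m : memory S) (h : {ffun J -> W}) : Prop :=
  forall j (i : 'I_wlen), m (bit_addr (inr (j, i))) = nth false (encode (h j)) i.

Definition shows (m : memory S) (o : olen.-tuple bool) : Prop :=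
  forall i, m (bit_addr (inl (inr i))) = tnth o i.

Lemma bit_addr_inj : injective bit_addr.
Proof. exact: enum_rank_inj. Qed.

Lemma represents_word m h j : represents m h -> [seq m a | a <- word_addrs j] = encode (h j).
Proof.
move=> mh; rewrite -map_comp; apply: (@eq_from_nth _ false).
  by rewrite size_map size_enum_ord size_bits.
move=> i; rewrite size_map size_enum_ord => lt_i.
by rewrite (nth_map (Ordinal lt_i)) ?size_enum_ord //= mh nth_enum_ord.
Qed.

Lemma represents_put m h j w :
  represents m h -> represents (foldl (@write _) m (word_writes j w)) (put h j w).
Proof.
move=> mh j' i; rewrite /put ffunE; case: eqP => [->|nj].
  rewrite (foldl_write_in (f := fun i => bit_addr (inr (j, i)))) ?mem_enum //.
  by move=> a b _ _ /bit_addr_inj [].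
rewrite foldl_write_notin ?mh //; apply/negP; rewrite /unzip1 -map_comp.
by case/mapP=> i' _ /bit_addr_inj [].
Qed.

Lemma exec_compile p m h : represents m h ->
  represents (exec (compile p) m) (run p h).2 /\ shows (exec (compile p) m) (run p h).1.
Proof.
elim: p m h => [o|j f IH|j w p IH] m h mh /=.
- rewrite exec_write_all /=; split.
    move=> j i; rewrite foldl_write_notin ?mh //; apply/negP; rewrite /unzip1 -map_comp.
    by case/mapP=> i' _ /bit_addr_inj.
  move=> i; rewrite (foldl_write_in (f := fun i => bit_addr (inl (inr i)))) ?mem_enum //.
  by move=> a b _ _ /bit_addr_inj [].
- by rewrite exec_read_all (represents_word _ mh) encodeK; apply: IH.
- by rewrite exec_write_all; apply/IH/represents_put.
Qed.

Definition word_in_addr (i : 'I_ilen) : 'I_S := bit_addr (inl (inl i)).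

Lemma word_in_addr_inj : injective word_in_addr.
Proof. by move=> i j /bit_addr_inj []. Qed.

Definition word_tree : dtree S :=
  read_all [seq word_in_addr i | i <- enum 'I_ilen]
    (fun s => compile (step_prog M [tuple nth false s i | i < ilen])).

Definition word_init (I : n.-tuple bool) : memory S :=
  [ffun a : 'I_S => match enum_val a with
             | inl (inl _) => false
             | inl (inr i) => tnth (init_out M I) i
             | inr (j, i) => nth false (encode (init_mem M I j)) i
             end].

Definition compiled : machine n ilen olen :=
  Machine word_in_addr_inj (fun i => bit_addr (inl (inr i))) word_init word_tree.

Lemma depth_compiled k : (forall x, costs (step_prog M x) k) ->
  depth (tree compiled) <= ilen + (k * wlen + olen).
Proof.
move=> Mk; apply: leq_trans (depth_read_all _ _) _; last first.
  by rewrite size_map size_enum_ord.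
by move=> r; apply: depth_compile.
Qed.

Lemma space_compiled : space compiled = ilen + olen + #|cell M| * wlen.
Proof. by rewrite /= !card_sum card_prod !card_ord. Qed.

Lemma step_compiled m h x : represents m h ->
  represents (step (M := compiled) m x) (run (step_prog M x) h).2 /\
  shows (step (M := compiled) m x) (run (step_prog M x) h).1.
Proof.
move=> mh; rewrite /step /= exec_read_all.
have -> : [tuple nth false [seq (load (M := compiled) x m) a
    | a <- [seq word_in_addr i | i <- enum 'I_ilen]] i | i < ilen] = x.
  apply: eq_from_tnth => i; rewrite tnth_mktuple -map_comp.
  rewrite (nth_map i) ?size_enum_ord //= nth_ord_enum /load ffunE.
  case: pickP => [i' /eqP /word_in_addr_inj -> //|/(_ i)].
  by rewrite /= eqxx.
apply: exec_compile => j i; rewrite /load ffunE.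
by case: pickP => [i' /eqP /bit_addr_inj|] //.
Qed.

Lemma output_compiled I xs : output_after compiled I xs = (word_run M I xs).1.
Proof.
rewrite /output_after /word_run.
set m := init _ I; set st := (_, _).
have : represents m st.2 /\ shows m st.1.
  by split=> [j i|i]; rewrite /m /= ffunE /bit_addr enum_rankK.
elim: xs m st => [|x xs IH] m st [mh mo] /=.
  by apply: eq_from_tnth => i; rewrite tnth_mktuple /= mo.
by apply: IH; apply: step_compiled.
Qed.

End Compile.

(** * Resource bounds for compiled families *)

Section Families.
Variables (ilen olen : nat -> nat) (M : forall n, word_machine n (ilen n) (olen n)).
Variable time : nat -> nat.
Hypotheses (ilenP : bounded_by (up_log 2) ilen) (olenP : bounded_by (up_log 2) olen).
Hypotheses (timeP : bounded_by (up_log 2) time)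
  (costsP : forall n x, costs (step_prog (M n) x) (time n)).
Hypothesis cellP : bounded_by id (fun n => #|cell (M n)|).
Hypothesis wordP : bounded_by (up_log 2) (fun n => up_log 2 #|word (M n)|).

Lemma depth_family : polylog_bounded (fun n => depth (tree (compiled (M n)))).
Proof.
apply/polylog_boundedP.
apply: bounded_le (fun n => depth_compiled (@costsP n)) _.
by apply/bounded_add/bounded_add=> //; apply: bounded_mul.
Qed.

Lemma space_family : poly_bounded (fun n => space (compiled (M n))).
Proof.
apply/poly_boundedP.
apply: (bounded_le (g := fun n => ilen n + olen n + #|cell (M n)| * wlen (M n))).
  by move=> n; rewrite space_compiled.
by apply/bounded_add/bounded_mul=> //; [apply: bounded_add|]; apply: bounded_polylog.
Qed.

End Families.

Lemma instance_sequence_take D n (I : n.-tuple bool)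
    (s : seq ((upd_len D n).-tuple bool * n.-tuple bool)) t :
  instance_sequence I s -> instance_sequence I (take t s).
Proof.
by elim: s I t => [|[u J] s IH] I [|t] //= [uE /IH]; move/(_ t).
Qed.

Lemma nth_unzip2 (U V : Type) (I : V) (s : seq (U * V)) t : t <= size s ->
  nth I (I :: unzip2 s) t = last I (unzip2 (take t s)).
Proof.
move=> ts; rewrite (last_nth I) /unzip2 map_take size_takel ?size_map //.
by case: t ts => // t ts; rewrite /= nth_take.
Qed.

(** Correctness at the end of every sequence is enough, because a prefix of an instance-sequence is
    again one. *)
Lemma Pdy_word_machine D (M : forall n, word_machine n (upd_len D n) 1) (time : nat -> nat) :
  bounded_by (up_log 2) time ->
  (forall n x, costs (step_prog (M n) x) (time n)) ->
  bounded_by id (fun n => #|cell (M n)|) ->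
  bounded_by (up_log 2) (fun n => up_log 2 #|word (M n)|) ->
  (forall n (I : n.-tuple bool) s, instance_sequence I s ->
     thead (word_run (M n) I (unzip1 s)).1 = answer D (last I (unzip2 s))) ->
  Pdy D.
Proof.
move=> timeP costsP cellP wordP MP; exists (fun n => compiled (M n)); split.
- apply: depth_family timeP costsP wordP; last exact: bounded_const.
  exact/Theta_log_bounded/upd_lenP.
- apply: space_family cellP wordP; last exact: bounded_const.
  exact/Theta_log_bounded/upd_lenP.
move=> c n I s sP _ t ts; rewrite output_compiled nth_unzip2 //.
by rewrite /unzip1 -map_take MP //; apply: instance_sequence_take.
Qed.

(** * Simulating an evaluator with huge memory in small space *)

(** This abstracts a DNF algorithm run on one formula from the all-false assignment. Its space may
    be huge: only the logarithm of the space and the depth of the trees will be paid for. *)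
Record evaluator nv (f : memory nv -> bool) := Evaluator {
  ev_space : nat;
  ev_init : memory ev_space;
  ev_tree : 'I_nv -> bool -> dtree ev_space;
  ev_out : 'I_ev_space;
  ev_outP : forall l : seq ('I_nv * bool),
    foldl (fun m ib => exec (ev_tree ib.1 ib.2) m) ev_init l ev_out
      = f (foldl (@write nv) [ffun=> false] l)
}.

Section Store.
Variables (nv : nat) (i0 : 'I_nv) (f : memory nv -> bool) (E : evaluator f) (d : nat).
Hypothesis depth_ev : forall i b, depth (ev_tree E i b) <= d.

Definition addr_len : nat := up_log 2 (ev_space E).
Local Notation k := addr_len.
(** Three reserved nodes, and room for [3 * nv] tree runs with at most [d] writes of [addr_len] new
    nodes each. A copy undergoes [2 * nv] runs while it is rebuilt (two per update) and [nv] more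
    while it is active. *)
Definition capacity : nat := 3 + 3 * nv * (d * addr_len).
Local Notation P := 'I_capacity.+1.

(* Cells: for each of the two copies b, a header [(b, None)] holding the root
   and the number of allocated nodes, and the nodes [(b, Some p)]; then the
   variables; then one control cell, holding which copy is active and the next
   variable to refresh. Every word has room for each of these uses. *)
Definition store_cell : finType := (bool * option P + 'I_nv + unit)%type.
Definition store_word : finType := ((P * P) * (bool * 'I_nv))%type.
Local Notation mem := {ffun store_cell -> store_word}.
Local Notation sprog := (prog store_cell store_word).

Definition pair_word (pq : P * P) : store_word := (pq, (false, i0)).
Definition flag_word (bi : bool * 'I_nv) : store_word := ((ord0, ord0), bi).
Definition Node (b : bool) (p : P) : store_cell := inl (inl (b, Some p)).
Definition Header (b : bool) : store_cell := inl (inl (b, None)).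
Definition Var (i : 'I_nv) : store_cell := inl (inr i).
Definition Control : store_cell := inr tt.

Definition child (x : bool) (pq : P * P) : P := if x then pq.2 else pq.1.
Definition set_child (x : bool) (pq : P * P) (r : P) : P * P :=
  if x then (pq.1, r) else (r, pq.2).

Definition node (m : mem) b p : P * P := (m (Node b p)).1.

(** * Binary tries with path copying *)

Fixpoint look (m : mem) b (s : bitseq) (p : P) : P :=
  if s is x :: s' then look m b s' (child x (node m b p)) else p.

(* Nodes 0, 1 and 2 are never allocated. At the bottom of the trie they stand
   for "absent", [false] and [true]; higher up, node 0 is the empty trie. *)
Definition wf (m : mem) b (c : nat) : Prop :=
  [/\ 2 < c, forall p : P, p < 3 -> node m b p = (ord0, ord0)
    & forall (p : P) x, p < c -> child x (node m b p) < c].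

(** Children of allocated nodes are allocated, so a lookup starting below [c] stays there and cannot
    see later allocations. *)
Lemma look_agree m m' b c s (p : P) : wf m b c -> p < c ->
  (forall q : P, q < c -> node m' b q = node m b q) ->
  look m' b s p = look m b s p /\ look m b s p < c.
Proof.
move=> [_ _ wfm] + mm'; elim: s p => [|x s IH] p pc //=.
by rewrite mm' //; apply: IH; apply: wfm.
Qed.

Lemma look0 m b c s : wf m b c -> look m b s ord0 = ord0.
Proof. by move=> [_ m0 _]; elim: s => //= x s IH; rewrite m0 //; case: x. Qed.

Fixpoint trie_get b (s : bitseq) (p : P) : sprog P :=
  if s is x :: s' then Get (Node b p) (fun w => trie_get b s' (child x w.1)) else Ret p.

(* The path to the new leaf is copied to the fresh nodes
   [c, ..., c + size s - 1], so nodes once allocated never change. *)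
Fixpoint trie_set b (s : bitseq) (p : P) (c : nat) (v : P) : sprog P :=
  if s is x :: s' then
    Get (Node b p) (fun w =>
      let! q := trie_set b s' (child x w.1) c v in
      Put (Node b (inord (c + size s'))) (pair_word (set_child x w.1 q))
        (Ret (inord (c + size s'))))
  else Ret v.

Lemma run_trie_get b s p m : run (trie_get b s p) m = (look m b s p, m).
Proof. by elim: s p => //= x s IH p; rewrite IH. Qed.

Lemma costs_trie_get b s p : costs (trie_get b s p) (size s).
Proof. by elim: s p => //= x s IH p w. Qed.

Lemma costs_trie_set b s p c v : costs (trie_set b s p c v) (2 * size s).
Proof.
elim: s p => // x s IH p.
apply: (@costs_le _ _ _ _ (2 * size s + 1).+1) => /= [|w]; first by lia.
exact: costs_bind.
Qed.

(** Induction on the path: the recursive call builds the new subtrie in fresh nodes, and one more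
    fresh node joins it to the old sibling subtrie. Leaf values count as nodes, whence [v < c]. *)
Lemma run_trie_set b s (p : P) c (v : P) m : wf m b c -> p < c -> v < c ->
  c + size s <= capacity.+1 ->
  let: (q, m') := run (trie_set b s p c v) m in
  [/\ forall j, (forall i : P, c <= i -> j <> Node b i) -> m' j = m j,
      wf m' b (c + size s), q < c + size s
    & forall s', size s' = size s ->
        look m' b s' q = if s' == s then v else look m b s' p].
Proof.
move=> wfm; elim: s p => [|x s IH] p pc vc cap /=.
  by rewrite addn0; split=> // -[].
have [_ _ wfc] := wfm; have cp := wfc p x pc.
have cs : c + size s < capacity.+1 by rewrite -addnS.
rewrite run_bind; have := IH _ cp vc (ltnW cs); rewrite -/(node m b p).
case: run => q m1 [fr wf1 qc lk] /=.
set r : P := inord _; have rE : r = c + size s :> nat by rewrite inordK.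
have [c3 low1 cl1] := wf1.
have nodeE (i : P) : node (put m1 (Node b r) (pair_word (set_child x (node m b p) q))) b i
    = if i == r then set_child x (node m b p) q else node m1 b i.
  rewrite /node /put ffunE; case: (i =P r) => [->|ir]; first by rewrite eqxx.
  by case: eqP => // -[].
have wf2 : wf (put m1 (Node b r) (pair_word (set_child x (node m b p) q))) b (c + (size s).+1).
  rewrite addnS; split=> [|i i3|i y]; first by rewrite ltnW.
    rewrite nodeE low1 //; case: eqP => // ir.
    by move: c3; rewrite -rE -ir ltnNge -ltnS i3.
  rewrite nodeE ltnS leq_eqVlt; case: (i =P r) => [-> _|ir].
    have h1 : q < (c + size s).+1 by rewrite ltnW.
    have h2 y' : child y' (node m b p) < (c + size s).+1.
      by apply: leq_trans (wfc _ _ pc) _; rewrite leqW ?leq_addr.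
    by have := h2 true; have := h2 false; case: (x); case: (y).
  case/orP=> [/eqP eir|/cl1 h]; last by rewrite ltnW // ltnS.
  by case: ir; apply: ord_inj; rewrite rE.
split=> // [j jfr||s'].
- rewrite /put ffunE; case: eqP => [jr|_]; last exact: fr.
  by case: (jfr r) => //; rewrite rE leq_addr.
- by rewrite addnS ltnS rE.
case: s' => // y s' [ss']; rewrite /= nodeE eqxx eqseq_cons.
have oldn (u : P) : u < c + size s ->
    node (put m1 (Node b r) (pair_word (set_child x (node m b p) q))) b u = node m1 b u.
  by move=> uc; rewrite nodeE; case: eqP => // ur; move: uc; rewrite ur rE ltnn.
have [xy|/negPf xy] := eqVneq y x.
  have -> : child y (set_child x (node m b p) q) = q by rewrite xy; case: (x).
  by have [-> _] := look_agree s' wf1 qc oldn; rewrite lk // xy.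
have -> : child y (set_child x (node m b p) q) = child y (node m b p).
  by move: xy; case: (x); case: (y).
have cy := wfc p y pc.
have cyc : child y (node m b p) < c + size s by apply: leq_trans cy (leq_addr _ _).
have [-> _] := look_agree s' wf1 cyc oldn.
(* The sibling subtrie lies below [c], where the recursive call wrote nothing. *)
suff oldm (u : P) : u < c -> node m1 b u = node m b u.
  by have [-> _] := look_agree s' wfm cy oldm.
move=> uc; rewrite /node fr // => i ci [] ui.
by move: uc; rewrite ui ltnNge ci.
Qed.

(** [b0] is the hard-wired initial bit, used when the trie records no deviation. *)
Definition leaf (b0 : bool) (v : P) : bool :=
  if v == 0 :> nat then b0 else 1 < v.
Definition leaf_of (b : bool) : P := inord b.+1.
Definition path_of (a : 'I_(ev_space E)) : bitseq := bits k a.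

Lemma leafK b0 b : leaf b0 (leaf_of b) = b.
Proof. by rewrite /leaf /leaf_of !inordK //; case: b. Qed.

Lemma path_of_inj : injective path_of.
Proof.
move=> a a' /(congr1 nat_of_bits).
by rewrite !bitsK ?(leq_trans (ltn_ord _) (up_logP _ _)) // => /val_inj.
Qed.

(* The virtual memory h differs from the initial memory of the evaluator only at
   the addresses recorded in the trie. *)
Definition trie_rep (m : mem) b (p : P) (c : nat) (h : memory (ev_space E)) : Prop :=
  [/\ wf m b c, p < c & forall a, h a = leaf (ev_init E a) (look m b (path_of a) p)].

Fixpoint trie_exec b (t : dtree (ev_space E)) (p : P) (c : nat) : sprog (P * P) :=
  match t with
  | Stop => Ret (p, inord c)
  | Read a t0 t1 =>
      let! v := trie_get b (path_of a) p in
      if leaf (ev_init E a) v then trie_exec b t1 p c else trie_exec b t0 p c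
  | Write a x t' =>
      let! q := trie_set b (path_of a) p c (leaf_of x) in trie_exec b t' q (c + k)
  end.

Lemma costs_trie_exec b t p c : costs (trie_exec b t p c) (depth t * (2 * k)).
Proof.
elim: t p c => [|a t0 IH0 t1 IH1|a x t IH] p c //=; rewrite mulSn.
  apply: costs_bind; first by apply: costs_le (costs_trie_get _ _ _); rewrite size_bits; lia.
  move=> v; case: ifP => _; apply: costs_le (IH1 _ _) || apply: costs_le (IH0 _ _).
    by rewrite leq_mul2r leq_maxr orbT.
  by rewrite leq_mul2r leq_maxl orbT.
apply: costs_bind => // ; apply: costs_le (costs_trie_set _ _ _ _ _).
by rewrite size_bits.
Qed.

(** Each write allocates [k] nodes and a read none, so [depth t * k] bounds the allocation; below
    [capacity] no [inord] overflows. *)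
Lemma run_trie_exec b t p c m h : trie_rep m b p c h ->
  c + depth t * k <= capacity ->
  let: (pc, m') := run (trie_exec b t p c) m in
  [/\ trie_rep m' b pc.1 pc.2 (exec t h), pc.2 <= c + depth t * k
    & forall j, (forall i, j <> Node b i) -> m' j = m j].
Proof.
elim: t p c m h => [|a t0 IH0 t1 IH1|a x t IH] p c m h rep cap /=.
- have cE : (inord c : P) = c :> nat by rewrite inordK // ltnS (leq_trans (leq_addr _ _) cap).
  by rewrite /= cE; split=> //; rewrite leq_addr.
- rewrite run_bind run_trie_get /=; have [_ _ hE] := rep; rewrite -hE.
  case: (h a); [have := IH1 p c m h rep|have := IH0 p c m h rep].
    have dl : depth t1 * k <= depth (Read a t0 t1) * k.
      by rewrite leq_mul2r leqW ?leq_maxr ?orbT.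
    move/(_ (leq_trans (leq_add (leqnn c) dl) cap)); case: run => pc m' [r pcl fr].
    by split=> //; apply: leq_trans pcl _; rewrite leq_add2l.
  have dl : depth t0 * k <= depth (Read a t0 t1) * k.
    by rewrite leq_mul2r leqW ?leq_maxl ?orbT.
  move/(_ (leq_trans (leq_add (leqnn c) dl) cap)); case: run => pc m' [r pcl fr].
  by split=> //; apply: leq_trans pcl _; rewrite leq_add2l.
have [wfm pc hE] := rep; have [c3 _ _] := wfm.
move: cap => /=; rewrite mulSn addnA => cap.
have vc : leaf_of x < c.
  by apply: leq_trans c3; rewrite ltnS inordK //; case: (x).
have szp : size (path_of a) = k by rewrite size_bits.
have c1 : c + size (path_of a) <= capacity.+1.
  by rewrite szp leqW // (leq_trans (leq_addr _ _) cap).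
rewrite run_bind; have := run_trie_set wfm pc vc c1.
case: run => q m1 [fr1 wf1 qc lk]; rewrite szp in wf1 qc lk; rewrite /=.
have rep1 : trie_rep m1 b q (c + k) [ffun a' => if a' == a then x else h a'].
  split=> // a'; rewrite ffunE lk ?size_bits // (inj_eq path_of_inj).
  by case: eqP => [->|_]; rewrite ?leafK.
have := IH q _ m1 _ rep1 cap; case: run => pc' m' [rep' pcl fr]; split=> //.
by move=> j nj; rewrite fr // fr1.
Qed.

(** * Copies of the evaluator state *)

Definition header (m : mem) b : P * P := (m (Header b)).1.

Definition copy (m : mem) b h (l : nat) : Prop :=
  trie_rep m b (header m b).1 (header m b).2 h /\ (header m b).2 <= 3 + l * (d * k).

Lemma wf_agree (m m' : mem) b c : (forall o, m' (inl (inl (b, o))) = m (inl (inl (b, o)))) ->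
  wf m b c -> wf m' b c.
Proof.
move=> mm' [c3 low cl].
have nE p : node m' b p = node m b p by rewrite /node mm'.
by split=> // p; [rewrite nE; apply: low|move=> x; rewrite nE; apply: cl].
Qed.

Lemma look_ext (m m' : mem) b s p : (forall o, m' (inl (inl (b, o))) = m (inl (inl (b, o)))) ->
  look m' b s p = look m b s p.
Proof. by move=> mm'; elim: s p => //= x s IH p; rewrite IH /node mm'. Qed.

Lemma copy_agree (m m' : mem) b h l : (forall o, m' (inl (inl (b, o))) = m (inl (inl (b, o)))) ->
  copy m b h l -> copy m' b h l.
Proof.
move=> mm' [[wfm pc hE] cl]; have hdE : header m' b = header m b by rewrite /header mm'.
rewrite /copy hdE; split=> //; split=> //; first exact: wf_agree wfm.
by move=> a; rewrite (look_ext _ _ mm').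
Qed.

Definition copy_exec b (t : dtree (ev_space E)) : sprog unit :=
  Get (Header b) (fun w : store_word =>
    let! pc := trie_exec b t w.1.1 w.1.2 in Put (Header b) (pair_word pc) (Ret tt)).

Lemma costs_copy_exec b i x : costs (copy_exec b (ev_tree E i x)) (d * (2 * k) + 2).
Proof.
rewrite addnS => w; apply: costs_bind => //.
by apply: costs_le (costs_trie_exec _ _ _ _); rewrite leq_mul2r depth_ev orbT.
Qed.

Definition outside b (j : store_cell) : bool :=
  if j is inl (inl (b', _)) then b' != b else true.

Lemma run_copy_exec b i x m h l : copy m b h l -> l < 3 * nv ->
  let: m' := (run (copy_exec b (ev_tree E i x)) m).2 in
  copy m' b (exec (ev_tree E i x) h) l.+1 /\ forall j, outside b j -> m' j = m j.
Proof.
move=> [rep cl] lnv; rewrite /= run_bind -/(header m b).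
have dk : depth (ev_tree E i x) * k <= d * k by rewrite leq_mul2r depth_ev orbT.
have cl' : (header m b).2 + depth (ev_tree E i x) * k <= 3 + l.+1 * (d * k).
  by rewrite mulSn addnCA addnC leq_add.
have cap : (header m b).2 + depth (ev_tree E i x) * k <= capacity.
  by apply: leq_trans cl' _; rewrite leq_add2l leq_mul2r lnv orbT.
have := run_trie_exec rep cap; case: run => pc m' [[wf' pc' hE'] pcl fr] /=.
set m2 := put _ _ _.
have mm2 o : m2 (inl (inl (b, Some o))) = m' (inl (inl (b, Some o))).
  by rewrite /m2 /put ffunE; case: eqP.
have hd2 : header m2 b = pc by rewrite /header /m2 /put ffunE eqxx.
have nE p : node m2 b p = node m' b p by rewrite /node mm2.
split; last first.
  move=> j jb; rewrite /m2 /put ffunE; case: eqP => [jE|_].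
    by move: jb; rewrite jE /= eqxx.
  by apply: fr => o jE; move: jb; rewrite jE /= eqxx.
rewrite /copy hd2; split; last exact: leq_trans pcl cl'.
split=> // [|a].
  case: wf' => c3 low cl2.
  by split=> // p; [rewrite nE; apply: low|move=> y; rewrite nE; apply: cl2].
rewrite hE'; congr leaf; elim: (path_of a) (pc.1) => //= y s IH p.
by rewrite nE IH.
Qed.

(** * The store: an active copy and a copy under reconstruction *)

Definition getv (i : 'I_nv) : sprog bool := Get (Var i) (fun w => Ret w.2.1).

Definition ask : sprog bool :=
  Get Control (fun w : store_word => Get (Header w.2.1) (fun h =>
    let! v := trie_get w.2.1 (path_of (ev_out E)) h.1.1 in Ret (leaf (ev_init E (ev_out E)) v))).

(** Both copies receive the update, so variables already refreshed in the standby copy stay current;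
    the standby copy then also receives variable [r]. After the last variable it takes over, and the
    former active copy is emptied through its header alone. *)
Definition setv (i : 'I_nv) (x : bool) : sprog unit :=
  Put (Var i) (flag_word (x, i0)) (Get Control (fun w : store_word =>
    let: (b, r) := w.2 in
    let! _ := copy_exec b (ev_tree E i x) in
    let! _ := copy_exec (~~ b) (ev_tree E i x) in
    Get (Var r) (fun y =>
      let! _ := copy_exec (~~ b) (ev_tree E r y.2.1) in
      if r.+1 == nv then
        Put (Header b) (pair_word (ord0, inord 3))
          (Put Control (flag_word (~~ b, insubd i0 0)) (Ret tt))
      else Put Control (flag_word (b, insubd i0 r.+1)) (Ret tt)))).

Definition ev_state (l : seq ('I_nv * bool)) :=
  foldl (fun m ib => exec (ev_tree E ib.1 ib.2) m) (ev_init E) l.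
Definition assigned (l : seq ('I_nv * bool)) : memory nv :=
  foldl (@write nv) [ffun=> false] l.

(* The active copy b has processed the updates la and is up to date; the other
   one, rebuilt from scratch, agrees with v on the variables below r. *)
Definition store_inv (v : memory nv) (m : mem) : Prop :=
  exists la lb b r,
  [/\ (m Control).2 = (b, r), forall i, (m (Var i)).2.1 = v i,
      copy m b (ev_state la) (size la) /\ copy m (~~ b) (ev_state lb) (size lb),
      assigned la = v /\ (forall i : 'I_nv, i < r -> assigned lb i = v i)
    & size la <= 2 * nv + r /\ size lb <= 2 * r].

Lemma run_getv v m i : store_inv v m -> run (getv i) m = (v i, m).
Proof. by case=> la [lb] [b] [r] [_ vE _ _ _] /=; rewrite vE. Qed.

Lemma run_ask v m : store_inv v m -> run ask m = (f v, m).
Proof.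
case=> la [lb] [b] [r] [ctl _ [[[_ _ hE] _] _] [<- _] _] /=.
by rewrite ctl /= run_bind run_trie_get /= -hE /ev_state ev_outP.
Qed.

Lemma costs_ask : costs ask (k + 2).
Proof.
rewrite addn2 => w h; rewrite -(addn0 k); apply: costs_bind => //.
by apply: costs_le (costs_trie_get _ _ _); rewrite size_bits.
Qed.

Lemma costs_setv i x : costs (setv i x) (6 * (d * k) + 12).
Proof.
pose e := d * (2 * k) + 2.
apply: (@costs_le _ _ _ _ (1 + (1 + (e + (e + (1 + (e + 2))))))); first by rewrite /e; nia.
rewrite /= => w; case: w.2 => b r; apply: costs_bind (costs_copy_exec _ _ _) _ => _.
apply: costs_bind (costs_copy_exec _ _ _) _ => _ y.
by apply: costs_bind (costs_copy_exec _ _ _) _ => _; case: ifP.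
Qed.

(** The old nodes become garbage that is unreachable from root 0, and the reserved nodes were never
    overwritten. *)
Lemma copy_reset m b h l : copy m b h l ->
  copy (put m (Header b) (pair_word (ord0, inord 3))) b (ev_init E) 0.
Proof.
move=> [[[c3 low cl] _ _] _]; set m' := put _ _ _.
have hd : header m' b = (ord0, inord 3) by rewrite /header /m' /put ffunE eqxx.
have i3 : (inord 3 : P) = 3 :> nat by rewrite inordK.
have nE p : node m' b p = node m b p by rewrite /node /m' /put ffunE; case: eqP.
have wf' : wf m' b 3.
  split=> // [p|p x] p3; rewrite nE low //; by case: x.
rewrite /copy hd /= i3; split=> //; split=> // a.
by rewrite (look0 _ wf').
Qed.

Lemma run_setv v m i x : store_inv v m ->
  store_inv (write v (i, x)) (run (setv i x) m).2.
Proof.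
case=> la [lb] [b] [r] [ctl vE [ca cb] [aE bE] [la_le lb_le]].
have rn := ltn_ord r; rewrite /=.
set m1 := put m _ _.
have m1j j : j <> Var i -> m1 j = m j by rewrite /m1 /put ffunE; case: eqP.
have m1v i' : (m1 (Var i')).2.1 = write v (i, x) i'.
  rewrite /m1 /put !ffunE /=; case: eqP => [[->]|ne]; rewrite ?eqxx //.
  by case: eqP => [E'|_ //]; case: ne; rewrite E'.
rewrite m1j // ctl /= run_bind.
have {}ca : copy m1 b (ev_state la) (size la) by apply: copy_agree ca => o; apply: m1j.
have {}cb : copy m1 (~~ b) (ev_state lb) (size lb) by apply: copy_agree cb => o; apply: m1j.
(* There is room: the active copy has processed at most [2 * nv + r] updates, and [r < nv]. *)
have [|ca2 fr2] := run_copy_exec i x ca; first by lia.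
move: ca2 fr2; set m2 := (run _ m1).2 => ca2 fr2.
have nb : ~~ b != b by case: (b).
have bn : b != ~~ b by case: (b).
have cb2 : copy m2 (~~ b) (ev_state lb) (size lb) by apply: copy_agree cb => o; apply: fr2.
rewrite run_bind.
have [|cb3 fr3] := run_copy_exec i x cb2; first by lia.
move: cb3 fr3; set m3 := (run _ m2).2 => cb3 fr3.
rewrite /= run_bind; set y := (m3 (Var r)).2.1.
(* The value is read after the assignment, so it is current even if [r] is [i]. *)
have yE : y = write v (i, x) r by rewrite /y fr3 // fr2 // m1v.
have [|cb4 fr4] := run_copy_exec r y cb3; first by lia.
move: cb4 fr4; set m4 := (run _ m3).2 => cb4 fr4.
have ca4 : copy m4 b (ev_state (rcons la (i, x))) (size (rcons la (i, x))).
  rewrite /ev_state foldl_rcons size_rcons; apply: copy_agree ca2 => o.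
  by rewrite fr4 // fr3.
have {}cb4 : copy m4 (~~ b) (ev_state (rcons (rcons lb (i, x)) (r, y)))
    (size (rcons (rcons lb (i, x)) (r, y))).
  by rewrite /ev_state !foldl_rcons !size_rcons.
have v4 i' : (m4 (Var i')).2.1 = write v (i, x) i' by rewrite fr4 // fr3 // fr2 // m1v.
have aE4 : assigned (rcons la (i, x)) = write v (i, x).
  by rewrite /assigned foldl_rcons -/(assigned la) aE.
have bE4 (j : 'I_nv) : j < r.+1 -> assigned (rcons (rcons lb (i, x)) (r, y)) j = write v (i, x) j.
  rewrite /assigned !foldl_rcons -/(assigned lb) ltnS leq_eqVlt ffunE /=.
  case: (j =P r) => [-> _|ne]; first exact: yE.
  case/orP=> [/eqP /val_inj //|jr]; rewrite !ffunE /=.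
  by case: eqP => // _; apply: bE.
case: eqP => [rN|rN] /=.
  (* The copies swap roles. The rebuilt one has processed at most [2 * r + 2], here [2 * nv],
     updates, as the invariant demands once the counter is back at 0. *)
  exists (rcons (rcons lb (i, x)) (r, y)), [::], (~~ b), (insubd i0 0).
  have i00 : insubd i0 0 = 0 :> nat by rewrite val_insubd (leq_trans _ rn).
  split.
  - by rewrite /put ffunE.
  - by move=> i'; rewrite -v4 /put !ffunE.
  - rewrite negbK; split.
      apply: copy_agree cb4 => o; rewrite /put !ffunE /=.
      by case: eqP => // -[] E'; case/negP: nb; apply/eqP.
    by apply: copy_agree (copy_reset ca4) => o; rewrite /put !ffunE /=.
  - split; last by move=> j; rewrite i00.
    by apply/ffunP=> j; rewrite bE4 // rN.
  - by rewrite !size_rcons i00 /=; split=> //; lia.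
have rlt : r.+1 < nv by rewrite ltn_neqAle rn andbT; apply/eqP.
have rE : insubd i0 r.+1 = r.+1 :> nat by rewrite val_insubd rlt.
exists (rcons la (i, x)), (rcons (rcons lb (i, x)) (r, y)), b, (insubd i0 r.+1); split.
- by rewrite /put ffunE.
- by move=> i'; rewrite -v4 /put !ffunE.
- by split; [apply: copy_agree ca4|apply: copy_agree cb4] => o; rewrite /put !ffunE /=.
- by split=> // j; rewrite rE; apply: bE4.
- by rewrite !size_rcons rE; split; lia.
Qed.

Definition blank : mem :=
  [ffun j => if j is inl (inl (_, None)) then pair_word (ord0, inord 3)
             else if j is inr _ then flag_word (false, insubd i0 0)
             else pair_word (ord0, ord0)].

Lemma blank_inv : store_inv [ffun=> false] blank.
Proof.
have cp b : copy blank b (ev_init E) 0.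
  have hd : header blank b = (ord0, inord 3) by rewrite /header ffunE.
  have nE p : node blank b p = (ord0, ord0) by rewrite /node ffunE.
  have i3 : (inord 3 : P) = 3 :> nat by rewrite inordK.
  have wfb : wf blank b 3 by split=> [|p p3|p x p3] //; rewrite nE; case: x.
  by rewrite /copy hd /= i3; split=> //; split=> // a; rewrite (look0 _ wfb).
have i00 : insubd i0 0 = 0 :> nat.
  by rewrite val_insubd (leq_trans _ (ltn_ord i0)).
exists [::], [::], false, (insubd i0 0); split=> //.
- by rewrite ffunE.
- by move=> i; rewrite !ffunE.
Qed.

(** Step 0 is uncharged, so the initial assignment may be entered by one ordinary update per
    variable. *)
Definition store_init (v : memory nv) : mem :=
  foldl (fun m i => (run (setv i (v i)) m).2) blank (enum 'I_nv).

Lemma store_init_inv v : store_inv v (store_init v).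
Proof.
have gen s m v0 : store_inv v0 m ->
    store_inv (foldl (@write nv) v0 [seq (i, v i) | i <- s])
              (foldl (fun m i => (run (setv i (v i)) m).2) m s).
  by elim: s m v0 => //= i s IH m v0 inv; apply/IH/run_setv.
have := gen (enum 'I_nv) _ _ blank_inv; congr store_inv; apply/ffunP=> i.
by rewrite (foldl_write_in (f := id)) ?mem_enum.
Qed.

End Store.

(** * Functions with small certificates as narrow DNF formulas *)

(** One-sided certificate complexity at most [w], which amounts to having a DNF of width [w]. *)
Definition certified nv (f : memory nv -> bool) (w : nat) : Prop :=
  forall v, f v ->
  exists2 s : seq 'I_nv, size s <= w & forall v' : memory nv, {in s, v' =1 v} -> f v'.

Lemma size_dnf_encode X :
  size (dnf_encode X) = (nvars X).+1 + (size (formula X)).+1 + nvars X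
                        + size (formula X) * (nvars X * 2).
Proof.
case: X => n F phi; rewrite /dnf_encode /=.
rewrite size_cat size_nseq /= size_cat size_nseq /= size_cat size_codom card_ord.
rewrite size_flatten /shape -map_comp.
rewrite (eq_map (g := fun=> n * 2)); last first.
  by move=> C; rewrite /= size_codom card_prod card_ord card_bool.
have -> : sumn [seq n * 2 | _ <- F] = size F * (n * 2) by elim: F => //= C F ->.
lia.
Qed.

Section DnfEvaluator.
Variables (c : nat) (A : algorithm_family (DNFdy c)).
Hypotheses (c_gt0 : 0 < c) (A_solves : solves A).
Variables (nv : nat) (i0 : 'I_nv) (f : memory nv -> bool) (w : nat).
Hypotheses (w_gt1 : 1 < w) (f_certified : certified f w).

Local Notation lit := ('I_nv * bool)%type.

Definition satisfied (C : {set lit}) (v : memory nv) : bool :=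
  [forall l in C, v l.1 == l.2].

(** Repetitions in the tuple account for clauses with fewer than [w] literals. *)
Definition implicants : seq {set lit} :=
  [seq C <- [seq [set l in t] | t : w.-tuple lit] | [forall v, satisfied C v ==> f v]].

(* The contradictory clauses make the number of clauses large enough for the
   width w to be polylogarithmic in it. *)
Definition cert_formula : seq {set lit} :=
  nseq (2 ^ w) [set (i0, true); (i0, false)] ++ implicants.

Lemma size_cert_formula : size cert_formula <= 2 ^ w + (nv * 2) ^ w.
Proof.
rewrite size_cat size_nseq leq_add2l size_filter (leq_trans (count_size _ _)) //.
by rewrite size_map -cardE card_tuple card_prod card_ord card_bool.
Qed.

Lemma eval_cert_formula v : dnf_eval (DnfInstance cert_formula v) = f v.
Proof.
rewrite /dnf_eval /= has_cat.
have -> : has (fun C : {set lit} => [forall l in C, v l.1 == l.2])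
   (nseq (2 ^ w) [set (i0, true); (i0, false)]) = false.
  rewrite has_nseq; apply/negbTE; rewrite negb_and; apply/orP; right.
  apply/negP=> /forall_inP h.
  have := h (i0, true); have := h (i0, false).
  by rewrite !inE !eqxx orbT => /(_ isT) /eqP /= -> /(_ isT).
rewrite /=; apply/hasP/idP => [[C]|fv].
  by rewrite mem_filter => /andP[/forallP /(_ v) /implyP fC _].
have [s ss fs] := f_certified fv.
(* Padding to length exactly [w] is harmless: all literals are read off [v], and extra ones only
   strengthen the implicant. *)
pose s' := s ++ nseq (w - size s) i0.
have sz : size [seq (i, v i) | i <- s'] == w.
  by rewrite size_map size_cat size_nseq subnKC.
exists [set l in Tuple sz].
  rewrite mem_filter; apply/andP; split; last by apply: map_f; rewrite mem_enum.
  apply/forallP=> v'; apply/implyP=> /forall_inP sat; apply: fs => i si.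
  have := sat (i, v i); rewrite inE => h; apply/eqP/h.
  by apply: map_f; rewrite mem_cat si.
by apply/forall_inP=> l; rewrite inE => /mapP[i _ ->].
Qed.

(** With at least [2 ^ w] clauses the logarithm of their number is at least [w], and [polylog c]
    dominates the logarithm for positive [c]. *)
Lemma narrow_cert_formula v : narrow c (DnfInstance cert_formula v).
Proof.
have wm : w <= polylog c (size cert_formula).
  have wl : w <= up_log 2 (size cert_formula).
    rewrite -(up_expnK w (isT : 1 < 2)); apply: leq_up_log.
    by rewrite size_cat size_nseq leq_addr.
  apply: leq_trans wl _; rewrite /polylog; set x := up_log _ _.
  apply: leq_trans (leq_addr _ _); case: c c_gt0 => // c' _.
  rewrite mulSn; apply: leq_trans (leq_addr _ _).
  by case: x => // x; rewrite expnS leq_pmulr // expn_gt0.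
apply/allP=> C /=; rewrite mem_cat => /orP[|].
  rewrite mem_nseq => /andP[_ /eqP ->]; apply: leq_trans wm.
  by rewrite cards2; apply: leq_trans w_gt1; rewrite ltnS leq_b1.
rewrite mem_filter => /andP[_ /mapP[t _ ->]]; apply: leq_trans wm.
by rewrite cardsE (leq_trans (card_size _)) ?size_tuple.
Qed.

(** The encoding length does not depend on the assignment, so all assignments give instances of one
    size. *)
Definition cert_len : nat :=
  size (dnf_encode (DnfInstance cert_formula [ffun=> false])).
Local Notation N := cert_len.

Lemma size_cert_encode v : size (dnf_encode (DnfInstance cert_formula v)) == N.
Proof. by rewrite /cert_len !size_dnf_encode. Qed.

Definition cert_encode (v : memory nv) : N.-tuple bool := Tuple (size_cert_encode v).

Lemma nv_le_cert_len : nv <= N.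
Proof. exact: nvars_encode (DnfInstance cert_formula [ffun=> false]). Qed.

Lemma size_upd_code k (l : lit) : size (l.2 :: bits k l.1) == k.+1.
Proof. by rewrite /= size_bits. Qed.

Definition upd_code (l : lit) : (dnf_upd_len N).-tuple bool := Tuple (size_upd_code _ l).

Lemma dnf_upd_code v l :
  dnf_upd c (cert_encode v) (upd_code l) = Some (cert_encode (write v l)).
Proof.
rewrite /dnf_upd /= dnf_encodeK narrow_cert_formula /= bitsK; last first.
  apply: leq_trans (up_logP _ _) => //.
  exact: leq_trans (ltn_ord _) nv_le_cert_len.
rewrite valK; have -> : dnf_encode (set_var (X := DnfInstance cert_formula v) l.1
    (thead (upd_code l))) = cert_encode (write v l) by [].
by rewrite valK.
Qed.

Fixpoint cert_trace (v : memory nv) (s : seq lit) :=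
  if s is l :: s' then (upd_code l, cert_encode (write v l)) :: cert_trace (write v l) s'
  else [::].

Lemma cert_trace_path v s :
  @instance_sequence (DNFdy c) N (cert_encode v) (cert_trace v s).
Proof. by elim: s v => //= l s IH v; split; rewrite ?dnf_upd_code. Qed.

Lemma unzip1_cert_trace v s : unzip1 (cert_trace v s) = map upd_code s.
Proof. by elim: s v => //= l s IH v; rewrite IH. Qed.

Lemma last_cert_trace v s :
  last (cert_encode v) (unzip2 (cert_trace v s)) = cert_encode (foldl (@write nv) v s).
Proof. by elim: s v => //= l s IH v; rewrite IH. Qed.

Lemma dnf_evaluatorP (s : seq lit) :
  foldl (fun m l => exec (step_tree (A N) (upd_code (l.1, l.2))) m)
    (init (A N) (cert_encode [ffun=> false])) s (out_addr (A N) ord0)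
  = f (foldl (@write nv) [ffun=> false] s).
Proof.
set v0 := [ffun=> false]; have := A_solves (cert_trace_path v0 s).
(* [solves] covers polynomially long sequences only. Since [poly c n] is at least [c], the length of
   the sequence itself can serve as the parameter. *)
move/(_ (size (cert_trace v0 s)) (leq_addl _ _) _ (leqnn _)).
rewrite nth_unzip2 // take_size last_cert_trace.
have -> : take (size (cert_trace v0 s)) (unzip1 (cert_trace v0 s)) = map upd_code s.
  by rewrite take_oversize ?size_map // unzip1_cert_trace.
rewrite /= /dnf_answer dnf_encodeK narrow_cert_formula eval_cert_formula /= => <-.
rewrite /output_after /thead tnth_mktuple; congr (_ _); congr (fun_of_fin _).
elim: s (init _ _) => //= -[i b] s IH m; rewrite IH; congr foldl.
by rewrite step_treeE.
Qed.

Definition dnf_evaluator : evaluator f :=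
  @Evaluator nv f _ (init (A N) (cert_encode [ffun=> false]))
    (fun i b => step_tree (A N) (upd_code (i, b))) (out_addr (A N) ord0) dnf_evaluatorP.

Lemma depth_dnf_evaluator i b :
  depth (ev_tree dnf_evaluator i b) <= dnf_upd_len N + depth (tree (A N)).
Proof. by rewrite /= depth_step_tree. Qed.

(** At most [2 * (nv * 2) ^ w] clauses are encoded in [nv * 2] bits each; four extra factors
    [nv * 2] cover these rows and the lower-order terms. *)
Lemma up_log_cert_len : up_log 2 N <= (w + 4) * up_log 2 (nv * 2).
Proof.
clear c_gt0; apply: leq_trans (up_log_exp _ _); apply: leq_up_log.
rewrite /N size_dnf_encode /=; have sz := size_cert_formula.
set b := nv * 2 in sz *; have b2 : 1 < b by rewrite /b; have := ltn_ord i0; lia.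
have bw : 2 ^ w <= b ^ w by rewrite leq_exp2r //; lia.
have b2w : b ^ 2 <= b ^ w by rewrite leq_exp2l.
rewrite expnD; move: sz bw b2w; move: (size _) (2 ^ w) (b ^ w) => m x y sz bw b2w.
have -> : b ^ 4 = b * b * b * b by rewrite !expnS expn0; lia.
have {}b2w : b * b <= y by rewrite mulnn.
have bE : b = nv + nv by rewrite /b; lia.
have h1 : b * 2 <= b * b by rewrite leq_mul2l b2 orbT.
have h2 : m * b <= 2 * y * b by rewrite leq_mul2r; apply/orP; right; lia.
have h3 : 2 * y * b <= y * b * b by nia.
have h4 : y * (b * b) <= y * b * b * b by nia.
have h5 : y * 4 <= y * (b * b) by nia.
have h6 : y * b * b * b * 2 <= y * b * b * b * b by nia.
nia.
Qed.

End DnfEvaluator.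

(** * Simulating a verifier with an evaluator *)

(** [s] lists the cells read on the computation path. Agreement there forces the same path and the
    same writes; an unwritten cell keeps its own value, whence the condition on [a]. *)
Lemma exec_local S (t : dtree S) (m : memory S) :
  exists2 s : seq 'I_S, size s <= depth t &
    forall m' : memory S, {in s, m' =1 m} ->
    forall a, m' a = m a -> exec t m' a = exec t m a.
Proof.
elim: t m => [|a t0 IH0 t1 IH1|a x t IH] m /=; first by exists [::].
- have [s ss sP] : exists2 s : seq 'I_S, size s <= maxn (depth t0) (depth t1) &
      forall m' : memory S, {in s, m' =1 m} -> forall b, m' b = m b ->
      exec (if m a then t1 else t0) m' b = exec (if m a then t1 else t0) m b.
    case: (m a); [have [s ss sP] := IH1 m|have [s ss sP] := IH0 m]; exists s => //.
      by rewrite leq_max ss orbT.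
    by rewrite leq_max ss.
  exists (a :: s) => // m' m'm b mb.
  rewrite m'm ?inE ?eqxx //; apply: sP => // i si.
  by rewrite m'm // inE si orbT.
- have [s ss sP] := IH [ffun a' => if a' == a then x else m a'].
  exists s; first exact: leqW.
  move=> m' m'm b mb; apply: sP => [i si|]; rewrite !ffunE; case: eqP => // _.
  exact: m'm.
Qed.

Section Simulation.
Variables (n ulen plen rlen : nat) (V : machine n (ulen + plen) rlen.+1).
Local Notation S := (space V).
Local Notation L := (plen + rlen).
Local Notation nv := (S + L).

Definition upd_writes (u : ulen.-tuple bool) : seq ('I_S * bool) :=
  [seq (in_addr V (lshift plen i), tnth u i) | i <- enum 'I_ulen].
Definition proof_writes (p : plen.-tuple bool) : seq ('I_S * bool) :=
  [seq (in_addr V (rshift ulen i), tnth p i) | i <- enum 'I_plen].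
Definition proof_tree (p : plen.-tuple bool) : dtree S :=
  write_all (proof_writes p) (tree V).

(** The update is common to all proofs, so it is written once, before the search; only the remaining
    tree depends on the proof. *)
Lemma step_split m u p :
  step m (cat_tuple u p) = exec (proof_tree p) (foldl (@write S) m (upd_writes u)).
Proof.
rewrite /step exec_write_all; congr exec; apply/ffunP=> a; rewrite ffunE.
have injl : injective (fun i => in_addr V (lshift plen i)).
  by move=> i j /in_addr_inj /lshift_inj.
have injr : injective (fun i => in_addr V (rshift ulen i)).
  by move=> i j /in_addr_inj /rshift_inj.
case: pickP => [i /eqP <-|noi]; last first.
  rewrite !foldl_write_notin //; apply/negP; rewrite /unzip1 -map_comp => /mapP[i _ ai].
    by have := noi (lshift plen i); rewrite ai eqxx.
  by have := noi (rshift ulen i); rewrite ai eqxx.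
case: (split_ordP i) => j ->.
  rewrite tnth_lshift foldl_write_notin; last first.
    apply/negP; rewrite /unzip1 -map_comp => /mapP[j' _ /in_addr_inj /eqP].
    by rewrite eq_lrshift.
  rewrite (foldl_write_in (f := fun i => in_addr V (lshift plen i))) ?mem_enum //.
  by move=> ? ? _ _ /injl.
rewrite tnth_rshift (foldl_write_in (f := fun i => in_addr V (rshift ulen i))) ?mem_enum //.
by move=> ? ? _ _ /injr.
Qed.

Definition var0 : 'I_nv := lshift L (out_addr V ord0).
Definition mem_var (a : 'I_S) : 'I_nv := lshift L a.
Definition thr_var (i : nat) : 'I_nv := insubd var0 (S + i).

Definition mem_of (v : memory nv) : memory S := [ffun a => v (mem_var a)].
Definition threshold (v : memory nv) : nat := \sum_(i < L) v (thr_var i) * 2 ^ i.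

(* The proof forms the low-order bits, so that the largest score is the largest
   reward and also determines a proof that achieves it. *)
Definition score (m : memory S) (p : plen.-tuple bool) : nat :=
  nat_of_bits (p ++ behead (output (M := V) (exec (proof_tree p) m))).

Definition best_score (m : memory S) : nat := \max_p score m p.

Definition query (v : memory nv) : bool := [exists p, threshold v <= score (mem_of v) p].

Lemma best_scoreP m : {p | best_score m = score m p}.
Proof. by apply: eq_bigmax; apply/card_gt0P; exists [tuple false | _ < plen]. Qed.

(** The query is thus monotone in the threshold, as binary search requires. *)
Lemma queryE v : query v = (threshold v <= best_score (mem_of v)).
Proof.
apply/existsP/idP => [[p tp]|]; first exact: leq_trans tp (leq_bigmax p).
by have [p ->] := best_scoreP (mem_of v) => tp; exists p.
Qed.

Lemma best_score_lt m : best_score m < 2 ^ L.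
Proof.
have [p ->] := best_scoreP m; apply: leq_trans (nat_of_bits_lt _) _.
by rewrite size_cat size_behead !size_tuple.
Qed.

Lemma val_thr_var i : i < L -> thr_var i = S + i :> nat.
Proof. by move=> iL; rewrite val_insubd ltn_add2l iL. Qed.

Lemma mem_thr_neq a i : i < L -> mem_var a != thr_var i.
Proof.
by move=> iL; rewrite -val_eqE /= val_thr_var // ltn_eqF // ltn_addr.
Qed.

Lemma thr_var_eq i j : i < L -> j < L -> (thr_var i == thr_var j) = (i == j).
Proof. by move=> iL jL; rewrite -val_eqE /= !val_thr_var // eqn_add2l. Qed.

Lemma mem_of_write_thr v i x : i < L -> mem_of (write v (thr_var i, x)) = mem_of v.
Proof.
by move=> iL; apply/ffunP=> a; rewrite !ffunE /= (negPf (mem_thr_neq a iL)).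
Qed.

Lemma mem_of_write v a x : mem_of (write v (mem_var a, x)) = write (mem_of v) (a, x).
Proof.
by apply/ffunP=> b; rewrite !ffunE /= (inj_eq (@lshift_inj _ _)).
Qed.

Lemma threshold_write v i x : i < L ->
  threshold (write v (thr_var i, x)) + v (thr_var i) * 2 ^ i = threshold v + x * 2 ^ i.
Proof.
move=> iL; rewrite /threshold (bigD1 (Ordinal iL)) //= [in RHS](bigD1 (Ordinal iL)) //=.
rewrite ffunE /= eqxx addnAC [RHS]addnAC [_ * _ + v _ * _]addnC; congr (_ + _).
apply: eq_bigr => j; rewrite -val_eqE /= => ji.
by rewrite ffunE /= thr_var_eq // (negPf ji).
Qed.

(** The depth of a proof tree, the output cells, the threshold bits, and 2 to make the width exceed
    1. *)
Definition cert_width : nat := plen + depth (tree V) + rlen.+1 + L + 2.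

Lemma query_certified : certified query cert_width.
Proof.
move=> v /existsP[p tp].
have [s ss sP] := exec_local (proof_tree p) (mem_of v).
(* Output cells belong to the certificate because the run may leave them unwritten. *)
exists (map mem_var s ++ map (fun i => mem_var (out_addr V i)) (enum 'I_rlen.+1)
        ++ map thr_var (iota 0 L)).
  rewrite !size_cat 2!size_map size_enum_ord size_map size_iota /cert_width.
  have szp : size (proof_writes p) = plen by rewrite size_map size_enum_ord.
  move: ss; rewrite depth_write_all szp; lia.
move=> v' vv'; apply/existsP; exists p.
have -> : threshold v' = threshold v.
  apply: eq_bigr => i _; rewrite vv' // !mem_cat (map_f thr_var) ?orbT //.
  by rewrite mem_iota ltn_ord.
rewrite /score; suff -> : output (M := V) (exec (proof_tree p) (mem_of v'))
    = output (M := V) (exec (proof_tree p) (mem_of v)) by [].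
apply: eq_from_tnth => i; rewrite !tnth_mktuple; apply: sP => [a sa|]; rewrite !ffunE vv' //.
  by rewrite mem_cat map_f.
by rewrite !mem_cat (map_f (fun i => mem_var (out_addr V i))) ?orbT // mem_enum.
Qed.

(** * Binary search for a best proof and execution of the verifier *)

Section Run.
Variables (E : evaluator query) (d : nat).
Hypothesis depth_ev : forall i b, depth (ev_tree E i b) <= d.
Local Notation set := (setv var0 E d).
Local Notation get := (getv E d).
Local Notation sprog := (prog (store_cell E d) (store_word E d)).
Local Notation inv := (@store_inv _ _ E d).

Fixpoint clear i : sprog unit :=
  if i is i'.+1 then let! _ := set (thr_var i') false in clear i' else Ret tt.

Fixpoint search i : sprog bitseq :=
  if i is i'.+1 then
    let! _ := set (thr_var i') true in
    let! b := ask E d in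
    let! _ := if b then Ret tt else set (thr_var i') false in
    let! s := search i' in Ret (rcons s b)
  else Ret [::].

Fixpoint simulate (t : dtree S) : sprog unit :=
  match t with
  | Stop => Ret tt
  | Read a t0 t1 => let! b := get (mem_var a) in if b then simulate t1 else simulate t0
  | Write a x t' => let! _ := set (mem_var a) x in simulate t'
  end.

Definition proof_of (s : bitseq) : plen.-tuple bool := [tuple nth false s i | i < plen].

Definition sim_step (u : ulen.-tuple bool) : sprog (1.-tuple bool) :=
  let! _ := simulate (write_all (upd_writes u) (Stop S)) in
  let! _ := clear L in
  let! s := search L in
  let! _ := simulate (proof_tree (proof_of s)) in
  let! b := get (mem_var (out_addr V ord0)) in
  Ret [tuple b].

Lemma run_clear i v m : i <= L -> inv v m ->
  exists v', [/\ inv v' (run (clear i) m).2, mem_of v' = mem_of v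
    & forall j, j < L -> v' (thr_var j) = (i <= j) && v (thr_var j)].
Proof.
elim: i v m => [|i IH] v m iL inv_v /=; first by exists v.
rewrite run_bind; have [] := IH _ _ (ltnW iL) (run_setv var0 depth_ev (thr_var i) false inv_v).
move=> v' [inv' memE thrE]; exists v'; split=> //; first by rewrite memE mem_of_write_thr.
move=> j jL; rewrite thrE // ffunE /= thr_var_eq // [in RHS]ltn_neqAle eq_sym.
by case: eqP => //=; rewrite andbF.
Qed.

(** Bits are decided from the most significant down; each query halves the interval known to contain
    the best score. *)
Lemma run_search i v m : i <= L -> inv v m ->
  (forall j, j < i -> v (thr_var j) = false) ->
  threshold v <= best_score (mem_of v) < threshold v + 2 ^ i ->
  size (run (search i) m).1 = i /\
  exists v', [/\ inv v' (run (search i) m).2, mem_of v' = mem_of v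
    & threshold v + nat_of_bits (run (search i) m).1 = best_score (mem_of v)].
Proof.
elim: i v m => [|i IH] v m iL inv_v low /andP[lo hi] /=.
  by split=> //; exists v; split=> //; move: hi; rewrite /= expn0; lia.
rewrite run_bind; have := run_setv var0 depth_ev (thr_var i) true inv_v.
move: (run _ m).2 => m1; set v1 := write v _ => inv1.
rewrite run_bind (run_ask inv1) /= queryE.
have mem1 : mem_of v1 = mem_of v by apply: mem_of_write_thr.
have thr1 : threshold v1 = threshold v + 2 ^ i.
  by have := threshold_write v true iL; rewrite low // mul0n mul1n addn0.
rewrite mem1; set b := _ <= _; rewrite run_bind.
have [v2 [inv2 mem2 thr2 low2]] : exists v2,
   [/\ inv v2 (run (if b then Ret tt else set (thr_var i) false) m1).2,
       mem_of v2 = mem_of v, threshold v2 = threshold v + b * 2 ^ i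
     & forall j, j < i -> v2 (thr_var j) = false].
  case: (b).
    exists v1; split=> //; first by rewrite mul1n.
    by move=> j ji; rewrite ffunE /= thr_var_eq ?(ltn_trans ji) // ltn_eqF // low // ltnW.
  exists (write v1 (thr_var i, false)); split.
  - exact: run_setv.
  - by rewrite mem_of_write_thr.
  - have := threshold_write v1 false iL; rewrite thr1 ffunE /= eqxx; lia.
  - by move=> j ji; rewrite !ffunE /= thr_var_eq ?(ltn_trans ji) // ltn_eqF // low // ltnW.
move: (run _ m1).2 inv2 => m2 inv2; rewrite run_bind.
have [|sz [v' [inv' mem' val']]] := IH v2 m2 (ltnW iL) inv2 low2.
  rewrite mem2 thr2; move: hi; rewrite expnS /b thr1.
  by case: leqP => /=; lia.
rewrite /= size_rcons sz; split=> //; exists v'; rewrite mem' mem2; split=> //.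
rewrite -cats1 nat_of_bits_cat sz (addn0 b : nat_of_bits [:: b] = b).
by rewrite [2 ^ i * b]mulnC [_ + b * _]addnC addnA -thr2 val' mem2.
Qed.

Lemma run_simulate t v m : inv v m ->
  exists v', inv v' (run (simulate t) m).2 /\ mem_of v' = exec t (mem_of v).
Proof.
elim: t v m => [|a t0 IH0 t1 IH1|a x t IH] v m inv_v /=; first by exists v.
- rewrite run_bind /=.
  have /= [->] := run_getv (mem_var a) inv_v.
  by rewrite ffunE; case: (v _); [apply: IH1|apply: IH0].
- rewrite run_bind.
  have [v' [inv' memE]] := IH _ _ (run_setv var0 depth_ev (mem_var a) x inv_v).
  by exists v'; split=> //; rewrite memE mem_of_write.
Qed.

Definition reward_of (m : memory S) : nat := nat_of_bits (behead (output (M := V) m)).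

Lemma run_sim_step u v m : inv v m ->
  exists p, (forall p', reward_of (step (mem_of v) (cat_tuple u p'))
                        <= reward_of (step (mem_of v) (cat_tuple u p))) /\
  exists v', [/\ inv v' (run (sim_step u) m).2, mem_of v' = step (mem_of v) (cat_tuple u p)
    & thead (run (sim_step u) m).1 = thead (output (M := V) (mem_of v'))].
Proof.
move=> inv_v; rewrite /sim_step run_bind.
have [v1 [inv1 mem1]] := run_simulate (write_all (upd_writes u) (Stop S)) inv_v.
rewrite exec_write_all /= in mem1; move: (run _ m).2 inv1 => m1 inv1; rewrite run_bind.
have [v2 [inv2 mem2 thr2]] := run_clear (leqnn L) inv1.
have {}thr2 j : j < L -> v2 (thr_var j) = false by move=> jL; rewrite thr2 // leqNgt jL.
have thr0 : threshold v2 = 0 by apply: big1 => i _; rewrite thr2.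
move: (run _ m1).2 inv2 => m2 inv2; rewrite run_bind.
have [|sz [v3 [inv3 mem3 val3]]] := run_search (leqnn L) inv2 thr2.
  by rewrite thr0 /= add0n best_score_lt.
move: (run (search L) m2) sz inv3 val3 => [s m3] /= sz inv3; rewrite thr0 add0n => val3.
have [p pE] := best_scoreP (mem_of v2).
have ps : proof_of s = p.
  (* Strings of equal length and equal value coincide, so the low-order bits found are a best proof
     itself. *)
  have sE : s = p ++ behead (output (M := V) (exec (proof_tree p) (mem_of v2))).
    apply: nat_of_bits_inj; last by rewrite val3 pE.
    by rewrite sz size_cat size_behead !size_tuple.
  apply: eq_from_tnth => i; rewrite tnth_mktuple sE nth_cat size_tuple ltn_ord.
  by rewrite (tnth_nth false).
rewrite ps run_bind; exists p; rewrite mem2 mem1 in pE mem3; split.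
  move=> p'; rewrite !step_split; set m0 := foldl _ _ _ in pE *.
  have : score m0 p' <= score m0 p by rewrite -pE; apply: leq_bigmax.
  rewrite /score !nat_of_bits_cat !size_tuple -/(reward_of _) -/(reward_of _).
  (* The proof contributes less than [2 ^ plen], so a larger reward would give a larger score. *)
  have := nat_of_bits_lt p; rewrite size_tuple.
  move: (reward_of _) (reward_of _) (nat_of_bits p') (nat_of_bits p) (2 ^ plen).
  by move=> x y a b k bk h; rewrite leqNgt; apply/negP=> yx; nia.
have [v4 [inv4 mem4]] := run_simulate (proof_tree p) inv3.
exists v4; rewrite step_split mem4 mem3; split=> //.
by rewrite run_bind (run_getv _ inv4) /= theadE /thead tnth_mktuple -mem3 -mem4 ffunE.
Qed.

End Run.
End Simulation.

(** * Cost of one simulated step *)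

Section SimulationCost.
Variables (n ulen plen rlen : nat) (V : machine n (ulen + plen) rlen.+1).
Variables (E : evaluator (@query _ _ _ _ V)) (d : nat).
Hypothesis depth_ev : forall i b, depth (ev_tree E i b) <= d.
Local Notation L := (plen + rlen).

Definition setv_cost : nat := 6 * (d * addr_len E) + 12.
Definition search_cost : nat := 2 * setv_cost + (addr_len E + 2).

Lemma costs_clear i : costs (clear E d i) (i * setv_cost).
Proof.
elim: i => // i IH; rewrite mulSn; apply: costs_bind => //.
exact: costs_setv.
Qed.

Lemma costs_search i : costs (search E d i) (i * search_cost).
Proof.
elim: i => // i IH.
apply: (@costs_le _ _ _ _ (setv_cost + (addr_len E + 2 + (setv_cost + (i * search_cost + 0))))).
  by rewrite mulSn /search_cost; lia.
apply: costs_bind; first exact: costs_setv.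
move=> _; apply: costs_bind; first exact: costs_ask.
move=> b; apply: costs_bind; first by case: b => //; apply: costs_setv.
by move=> _; apply: costs_bind.
Qed.

Lemma costs_simulate t : costs (simulate E d t) (depth t * setv_cost).
Proof.
elim: t => [|a t0 IH0 t1 IH1|a x t IH] //; rewrite mulSn.
  apply: costs_bind.
    by apply: (@costs_le _ _ _ _ 1) => //; rewrite /setv_cost; lia.
  by move=> b; case: b; [apply: costs_le IH1|apply: costs_le IH0];
    rewrite leq_mul2r ?leq_maxr ?leq_maxl orbT.
by apply: costs_bind => //; apply: costs_setv.
Qed.

Definition sim_cost : nat :=
  (ulen + L + (plen + depth (tree V))) * setv_cost + L * search_cost + 1.

Lemma costs_sim_step u : costs (sim_step E d u) sim_cost.
Proof.
apply: (@costs_le _ _ _ _ (ulen * setv_cost + (L * setv_cost + (L * search_cost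
   + ((plen + depth (tree V)) * setv_cost + (1 + 0)))))).
  by rewrite /sim_cost; lia.
apply: costs_bind.
  have := costs_simulate (write_all (upd_writes V u) (Stop _)).
  by rewrite depth_write_all size_map size_enum_ord addn0.
move=> _; apply: costs_bind; first exact: costs_clear.
move=> _; apply: costs_bind; first exact: costs_search.
move=> s; apply: costs_bind.
  have := costs_simulate (proof_tree V (proof_of plen s)).
  by rewrite depth_write_all size_map size_enum_ord.
by move=> _; apply: costs_bind.
Qed.

End SimulationCost.

(** * Hardness *)

Section Hardness.
Variables (c : nat) (A : algorithm_family (DNFdy c)).
Hypotheses (c_gt0 : 0 < c) (A_solves : solves A).
Hypotheses (A_depth : polylog_bounded (fun n => depth (tree (A n))))
  (A_space : poly_bounded (fun n => space (A n))).
Variables (D : dynamic_problem) (plen rlen : nat -> nat) (V : verifier_family D plen rlen).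
Hypotheses (plenP : polylog_bounded plen) (rlenP : polylog_bounded rlen)
  (V_depth : polylog_bounded (fun n => depth (tree (V n))))
  (V_space : poly_bounded (fun n => space (V n))).
Hypothesis V_correct : forall n (I0 : n.-tuple bool) s, instance_sequence I0 s ->
  forall ps : seq ((plen n).-tuple bool), size ps = size s ->
    (forall t, t <= size s ->
       answer D (nth I0 (I0 :: unzip2 s) t) = false ->
       verdict V I0 (unzip1 s) (take t ps) = false)
    /\
    (reward_maximizing V I0 (unzip1 s) ps ->
     forall t, t <= size s ->
       answer D (nth I0 (I0 :: unzip2 s) t) = true ->
       verdict V I0 (unzip1 s) (take t ps) = true).

Local Notation width n := (cert_width (V n)).
Local Notation N n := (cert_len (var0 (V n)) (query (V := V n)) (width n)).
Local Notation nv n := (space (V n%N) + (plen n%N + rlen n%N)).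

Lemma width_gt1 n : 1 < width n.
Proof. by rewrite /cert_width addn2. Qed.

Definition sim_evaluator n : evaluator (query (V := V n)) :=
  dnf_evaluator c_gt0 A_solves (var0 (V n)) (width_gt1 n) (@query_certified _ _ _ _ (V n)).

Definition sim_depth n : nat := dnf_upd_len (N n) + depth (tree (A (N n))).

Lemma depth_sim_evaluator n i b : depth (ev_tree (sim_evaluator n) i b) <= sim_depth n.
Proof. exact: depth_dnf_evaluator. Qed.

Definition sim_assignment n (I : n.-tuple bool) : memory (nv n) :=
  [ffun i => if split i is inl a then init (V n) I a else false].

Lemma mem_of_sim_assignment n (I : n.-tuple bool) :
  mem_of (V := V n) (sim_assignment I) = init (V n) I.
Proof. by apply/ffunP=> a; rewrite !ffunE (unsplitK (inl _ a)). Qed.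

(** The output of step 0 may depend arbitrarily on the instance, so it is the answer itself. *)
Definition sim_machine n : word_machine n (upd_len D n) 1 :=
  @WordMachine n (upd_len D n) 1 (store_cell (sim_evaluator n) (sim_depth n))
    (store_word (sim_evaluator n) (sim_depth n))
    (flag_word _ _ (false, var0 (V n)))
    (fun I => [tuple answer D I])
    (fun I => store_init (var0 (V n)) (sim_evaluator n) (sim_depth n) (sim_assignment I))
    (@sim_step _ _ _ _ (V n) (sim_evaluator n) (sim_depth n)).

(** The proofs found by the searches form one reward-maximizing sequence. Induction is on the last
    update, since maximality at a step concerns only the prefix up to it. *)
Lemma sim_run n (I : n.-tuple bool) us :
  exists ps : seq ((plen n).-tuple bool), exists v : memory (nv n),
  [/\ size ps = size us, reward_maximizing V I us ps,
      store_inv v (word_run (sim_machine n) I us).2,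
      mem_of (V := V n) v = foldl (@step _ _ _ (V n)) (init (V n) I)
                     [seq cat_tuple up.1 up.2 | up <- zip us ps]
    & us != [::] -> thead (word_run (sim_machine n) I us).1 = verdict V I us ps].
Proof.
elim/last_ind: us => [|us u [ps [v [sz rm inv memE _]]]].
  exists [::], (sim_assignment I); split=> //; last exact: mem_of_sim_assignment.
  by apply: store_init_inv; apply: depth_sim_evaluator.
have [p [pmax [v' [inv' mem' out']]]] := run_sim_step (@depth_sim_evaluator n) u inv.
have zipE q : zip (rcons us u) (rcons ps q) = rcons (zip us ps) (u, q).
  by rewrite zip_rcons.
have zip_take (q : seq ((plen n).-tuple bool)) : size q <= size us ->
    zip (rcons us u) q = zip us q.
  move=> qs; rewrite -{1}[q]cats0 -cats1.
  elim: q us qs {sz rm inv memE inv' mem' out' pmax zipE} => [|x q IH] [|y us] //= qs.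
  by rewrite IH.
exists (rcons ps p), v'.
have memE' q : foldl (@step _ _ _ (V n)) (init (V n) I)
    [seq cat_tuple up.1 up.2 | up <- zip (rcons us u) (rcons ps q)]
    = step (mem_of (V := V n) v) (cat_tuple u q).
  by rewrite zipE map_rcons foldl_rcons -memE.
split.
- by rewrite !size_rcons sz.
- have take_ps t : t <= size ps -> take t (rcons ps p) = take t ps.
    by move=> tps; rewrite -cats1 takel_cat.
  move=> t; rewrite size_rcons ltnS leq_eqVlt => /orP[/eqP ->|tlt] q.
    rewrite take_ps // take_size take_oversize ?size_rcons //.
    rewrite /reward /verifier_output /output_after !memE'; exact: pmax.
  have := rm t tlt q; rewrite !take_ps ?(ltnW tlt) //.
  rewrite /reward /verifier_output !zip_take //; first by rewrite -sz size_takel.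
  by rewrite size_rcons size_takel -?sz // ltnW.
- by rewrite /word_run foldl_rcons.
- by rewrite memE' mem'.
- move=> _; rewrite /word_run foldl_rcons -/(word_run _ _ _) [LHS]out' mem'.
  by rewrite /verdict /verifier_output /output_after memE'.
Qed.

Lemma sim_correct n (I : n.-tuple bool) s : instance_sequence I s ->
  thead (word_run (sim_machine n) I (unzip1 s)).1 = answer D (last I (unzip2 s)).
Proof.
move=> sP; have [->|s_nil] := eqVneq s [::]; first by rewrite /= theadE.
have [ps [v [sz rm _ _ ->]]] := sim_run I (unzip1 s); last by case: (s) s_nil.
rewrite size_map in sz; have [V0 V1] := V_correct sP sz.
have := V0 _ (leqnn _); have := V1 rm _ (leqnn _).
rewrite nth_unzip2 // take_size -sz take_size.
by case: answer => [->|_ ->].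
Qed.

(** * Resource bounds of the simulation *)

Local Notation plb := (bounded_by (up_log 2)).

Lemma plen_bound : plb plen. Proof. exact/polylog_boundedP. Qed.
Lemma rlen_bound : plb rlen. Proof. exact/polylog_boundedP. Qed.

Lemma nv_bound : bounded_by id (fun n => nv n).
Proof.
apply: bounded_add; first exact/poly_boundedP.
by apply: bounded_add; apply: bounded_polylog; [exact: plen_bound|exact: rlen_bound].
Qed.

Lemma width_bound : plb (fun n => width n).
Proof.
have [hp hr] := (plen_bound, rlen_bound).
apply: bounded_add (bounded_const _ _); apply: bounded_add; last exact: bounded_add.
apply: bounded_add; last exact: bounded_succ.
by apply: bounded_add => //; apply/polylog_boundedP.
Qed.

Lemma cert_len_bound : plb (fun n => up_log 2 (N n)).
Proof.
apply: (bounded_le (g := fun n => (width n + 4) * up_log 2 (nv n * 2))).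
  by move=> n; apply: up_log_cert_len; apply: width_gt1.
apply: bounded_mul.
  exact: bounded_add width_bound (bounded_const _ _).
apply: bounded_up_log_poly; apply: bounded_mul (bounded_const _ _).
exact: nv_bound.
Qed.

Lemma sim_depth_bound : plb sim_depth.
Proof.
apply: bounded_add; first exact/bounded_succ/cert_len_bound.
apply: (bounded_comp (f := fun m => depth (tree (A m))) _ cert_len_bound).
exact/polylog_boundedP.
Qed.

Lemma addr_len_bound : plb (fun n => addr_len (sim_evaluator n)).
Proof.
apply: (bounded_comp (f := fun m => up_log 2 (space (A m))) _ cert_len_bound).
exact/bounded_up_log_poly/poly_boundedP.
Qed.

(** The quasi-polynomial space of the DNF algorithm enters only through its address length, which is
    polylogarithmic. *)
Lemma capacity_bound : bounded_by id (fun n => capacity (sim_evaluator n) (sim_depth n)).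
Proof.
apply: bounded_add; first exact: bounded_const.
apply: bounded_mul; first exact: bounded_mul (bounded_const _ _) nv_bound.
by apply: bounded_polylog; apply: bounded_mul sim_depth_bound addr_len_bound.
Qed.

Lemma setv_cost_bound : plb (fun n => setv_cost (sim_evaluator n) (sim_depth n)).
Proof.
apply: bounded_add (bounded_const _ _); apply: bounded_mul (bounded_const _ _) _.
exact: bounded_mul sim_depth_bound addr_len_bound.
Qed.

Lemma sim_cost_bound : plb (fun n => sim_cost (sim_evaluator n) (sim_depth n)).
Proof.
have [hp hr] := (plen_bound, rlen_bound).
have hu := Theta_log_bounded (upd_lenP D).
apply: bounded_add (bounded_const _ _); apply: bounded_add.
  apply: bounded_mul setv_cost_bound; apply: bounded_add.
    by apply: bounded_add => //; apply: bounded_add.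
  by apply: bounded_add => //; apply/polylog_boundedP.
apply: bounded_mul; first exact: bounded_add.
apply: bounded_add; first exact: bounded_mul (bounded_const _ _) setv_cost_bound.
exact: bounded_add addr_len_bound (bounded_const _ _).
Qed.

Lemma NPdy_in_Pdy : Pdy D.
Proof.
apply: (Pdy_word_machine (M := sim_machine) sim_cost_bound).
- by move=> n x; apply: costs_sim_step; apply: depth_sim_evaluator.
- apply: (bounded_le (g := fun n => 2 * (capacity (sim_evaluator n) (sim_depth n)).+2
      + nv n + 1)).
    by move=> n; rewrite /= !card_sum card_prod card_option !card_ord card_bool card_unit.
  apply: bounded_add (bounded_const _ _); apply: bounded_add nv_bound.
  apply: bounded_mul (bounded_const _ _) _.
  exact/bounded_succ/bounded_succ/capacity_bound.
- apply: bounded_up_log_poly.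
  apply: (bounded_le (g := fun n => (capacity (sim_evaluator n) (sim_depth n)).+1
      * (capacity (sim_evaluator n) (sim_depth n)).+1 * (2 * nv n))).
    by move=> n; rewrite /= !card_prod !card_ord card_bool.
  have h := bounded_succ capacity_bound.
  apply: bounded_mul; first exact: bounded_mul.
  exact: bounded_mul (bounded_const _ _) nv_bound.
- exact: sim_correct.
Qed.

End Hardness.

(** * Membership *)

Section Membership.
Variables (c n : nat).

Definition clause_width : nat := polylog c n.
Definition dnf_cell : finType := ('I_n.+1 * 'I_clause_width.+1 + 'I_n.+1)%type.
(** A word is a truth value or a literal; [None] fills the positions past the end of a clause and
    counts as satisfied. *)
Definition dnf_word : finType := option (bool + 'I_n.+1 * bool).
Local Notation mem := {ffun dnf_cell -> dnf_word}.

Definition bool_word (b : bool) : dnf_word := Some (inl b).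
Definition lit_word m (l : 'I_m * bool) : dnf_word := Some (inr (inord l.1, l.2)).

(* The constant [false] stored for absent clauses makes them unsatisfied. *)
Definition dnf_mem (X : dnf_instance) : mem :=
  [ffun a : dnf_cell => match a with
             | inl (k, j) =>
                 if k < size (formula X)
                 then nth None [seq lit_word l | l <- enum (nth set0 (formula X) k)] j
                 else bool_word false
             | inr i => bool_word (if insub (i : nat) is Some i' then assignment X i' else false)
             end].

Definition check (x : dnf_word) : prog dnf_cell dnf_word bool :=
  match x with
  | None => Ret true
  | Some (inl b) => Ret b
  | Some (inr (i, b)) => Get (inr i : dnf_cell) (fun y => Ret (y == bool_word b))
  end.

Fixpoint check_clause (k : 'I_n.+1) (s : seq 'I_clause_width.+1) :
    prog dnf_cell dnf_word bool :=
  if s is j :: s' then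
    Get (inl (k, j) : dnf_cell) (fun x =>
      let! b := check x in let! b' := check_clause k s' in Ret (b && b'))
  else Ret true.

Definition checked (m : mem) (x : dnf_word) : bool := (run (check x) m).1.

Lemma run_check x m : run (check x) m = (checked m x, m).
Proof. by rewrite /checked; case: x => [[b|[i b]]|]. Qed.

Lemma run_check_clause k s m :
  run (check_clause k s) m = (all (fun j => checked m (m (inl (k, j)))) s, m).
Proof. by elim: s => //= j s IH; rewrite run_bind run_check /= run_bind IH. Qed.

Lemma costs_check_clause k s : costs (check_clause k s) (2 * size s).
Proof.
elim: s => // j s IH.
apply: (@costs_le _ _ _ _ (1 + (1 + (2 * size s + 0)))) => /=; first by lia.
move=> x; apply: (@costs_bind _ _ _ _ _ _ 1).
  by case: x => [[b|[i b]]|].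
by move=> b; apply: costs_bind.
Qed.

Definition clause_ok (X : dnf_instance) (k : nat) : bool :=
  (k < size (formula X)) && [forall l in nth set0 (formula X) k, assignment X l.1 == l.2].

Lemma checked_clause X (k : 'I_n.+1) : nvars X <= n ->
  #|nth set0 (formula X) k| <= clause_width ->
  all (fun j => checked (dnf_mem X) (dnf_mem X (inl (k, j)))) (enum 'I_clause_width.+1)
  = clause_ok X k.
Proof.
move=> Xn Cw; rewrite /clause_ok.
have memE j : dnf_mem X (inl (k, j)) = if k < size (formula X)
    then nth None [seq lit_word l | l <- enum (nth set0 (formula X) k)] j
    else bool_word false by rewrite ffunE.
case: (k < size (formula X)) memE => memE /=; last first.
  (* Every clause has at least one position, so an absent clause contains a stored [false]. *)
  by apply/negbTE/allPn; exists ord0; rewrite ?mem_enum // memE.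
have litE l : checked (dnf_mem X) (lit_word l) = (assignment X l.1 == l.2).
  case: l => i b; rewrite /checked /= ffunE /bool_word.
  have iE : (inord i : 'I_n.+1) = i :> nat by rewrite inordK // leqW // (leq_trans (ltn_ord i)).
  rewrite iE valK; apply/eqP/eqP => [[]//|->//].
set C := nth _ _ _ in memE Cw *.
apply/allP/forall_inP => [h l lC|h j _].
  have lj : index l (enum C) < clause_width.+1.
    by rewrite ltnS (leq_trans _ Cw) // cardE index_size.
  have := h (Ordinal lj); rewrite mem_enum => /(_ isT).
  by rewrite memE /= (nth_map l) ?index_mem ?mem_enum // nth_index ?mem_enum // litE.
rewrite memE; have [jC|Cj] := ltnP j (size (enum C)); last first.
  by rewrite nth_default // size_map.
have [l0 _] : exists l0, l0 \in enum C by case: (enum C) jC => // l s _; exists l; rewrite inE eqxx.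
rewrite (nth_map l0) // litE; apply: h.
by rewrite -mem_enum mem_nth.
Qed.

Lemma dnf_mem_set X (i : 'I_(nvars X)) b : nvars X <= n ->
  put (dnf_mem X) (inr (inord i)) (bool_word b) = dnf_mem (set_var i b).
Proof.
move=> Xn; have iE : (inord i : 'I_n.+1) = i :> nat.
  by rewrite inordK // leqW // (leq_trans (ltn_ord i)).
apply/ffunP=> -[[k j]|i']; rewrite /put !ffunE //=.
have -> : (inr i' == inr (inord i) :> dnf_cell) = (i' == i :> nat).
  by apply/eqP/eqP => [[->] //|ii]; congr inr; apply: ord_inj; rewrite iE.
case: insubP => [i1 _ <-|]; first by rewrite ffunE -val_eqE /=; case: eqP.
by case: eqP => // ->; rewrite ltn_ord.
Qed.

Local Notation ulen := (dnf_upd_len n).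
Local Notation plen := (up_log 2 n).

Definition instance_mem (I : n.-tuple bool) : mem :=
  if dnf_decode I is Some X then dnf_mem X else [ffun=> None].

(** One bit serves as verdict and as reward, so a reward-maximizing proof names a satisfied clause
    whenever one exists. *)
Definition verify_step (x : (ulen + plen).-tuple bool) : prog dnf_cell dnf_word (2.-tuple bool) :=
  Put (inr (inord (nat_of_bits (behead (take ulen x)))) : dnf_cell)
      (bool_word (head false x))
      (let! r := check_clause (inord (nat_of_bits (drop ulen x))) (enum 'I_clause_width.+1) in
       Ret [tuple r; r]).

Definition dnf_verifier : word_machine n (ulen + plen) 2 :=
  @WordMachine n (ulen + plen) 2 dnf_cell dnf_word None
    (fun I => [tuple dnf_answer c I; false]) instance_mem verify_step.

Lemma costs_verify_step x : costs (verify_step x) (1 + (2 * clause_width.+1 + 0)).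
Proof.
apply: (@costs_bind _ _ _ _ (check_clause _ _) _ (2 * clause_width.+1) 0) => //.
by have := costs_check_clause (inord (nat_of_bits (drop ulen x))) (enum 'I_clause_width.+1);
  rewrite size_enum_ord.
Qed.

(** [inord] sends a number above [n] to clause 0. Soundness is unaffected, since that clause is then
    really checked. *)
Definition proof_ok (J : n.-tuple bool) (p : plen.-tuple bool) : bool :=
  if dnf_decode J is Some X then clause_ok X (inord (nat_of_bits p) : 'I_n.+1) else false.

Definition proof_out J p : 2.-tuple bool := [tuple proof_ok J p; proof_ok J p].

Lemma dnf_encoded_size (J : n.-tuple bool) X : dnf_decode J = Some X ->
  size (dnf_encode X) = n.
Proof. by move=> JX; have := dnf_decodeK J; rewrite JX /= => ->; rewrite size_tuple. Qed.

Lemma dnf_updP (I J : n.-tuple bool) u : dnf_upd c I u = Some J ->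
  exists X (i : 'I_(nvars X)), [/\ dnf_decode I = Some X, narrow c X,
    nat_of_bits (behead u) = i & dnf_decode J = Some (set_var i (thead u))].
Proof.
rewrite /dnf_upd; case IX: (dnf_decode I) => [X|] //.
case: ifP => // nX; case: insubP => // i _ iE; case: insubP => // J' _ JE [<-].
by exists X, i; split=> //; rewrite JE dnf_encodeK.
Qed.

(** The number of clauses is at most the encoding length, so the width bound may be taken at [n]. *)
Lemma narrow_width X k : size (dnf_encode X) = n -> narrow c X ->
  #|nth set0 (formula X) k| <= clause_width.
Proof.
move=> Xn /allP nX; have [kF|Fk] := ltnP k (size (formula X)); last first.
  by rewrite nth_default // cards0.
apply: leq_trans (nX _ (mem_nth _ kF)) _; rewrite /clause_width /polylog leq_add2r leq_mul2l.
apply/orP; right; case: (c) => // c'; rewrite leq_exp2r //; apply: leq_up_log.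
by rewrite -Xn size_dnf_encode; lia.
Qed.

Lemma run_verify_step I J u p : dnf_upd c I u = Some J ->
  run (verify_step (cat_tuple u p)) (instance_mem I) = (proof_out J p, instance_mem J).
Proof.
move=> /dnf_updP[X [i [IX nX iE JX]]].
have szX := dnf_encoded_size IX.
have Xn : nvars X <= n by rewrite -szX nvars_encode.
rewrite /verify_step /= run_bind.
rewrite take_size_cat ?size_tuple // drop_size_cat ?size_tuple // iE.
have -> : head false (u ++ p) = thead u by case/tupleP: u {iE JX} => b u.
rewrite /instance_mem IX JX dnf_mem_set // run_check_clause checked_clause //;
  last exact: narrow_width szX nX.
by rewrite /proof_out /proof_ok JX.
Qed.

Lemma word_run_verifier (I : n.-tuple bool) s (ps : seq (plen.-tuple bool)) :
  @instance_sequence (DNFdy c) n I s -> size ps = size s ->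
  (word_run dnf_verifier I [seq cat_tuple up.1 up.2 | up <- zip (unzip1 s) ps]).1
  = if ps is p :: ps' then proof_out (last I (unzip2 s)) (last p ps')
    else [tuple dnf_answer c I; false].
Proof.
rewrite /word_run -[[tuple dnf_answer c I; false]]/(init_out dnf_verifier I).
move: (init_out _ I) => o.
elim: s I ps o => [|[u J] s IH] I [|p ps] o // [uJ sP] [sz].
have {}IH := IH J ps (proof_out J p) sP sz.
rewrite -(run_verify_step p uJ) in IH; apply: etrans IH _.
by case: ps s {sP} sz => [|p' ps] [|[u' J'] s].
Qed.

Lemma proof_ok_answer (J : n.-tuple bool) p :
  (forall X, dnf_decode J = Some X -> narrow c X) -> proof_ok J p -> dnf_answer c J.
Proof.
rewrite /proof_ok /dnf_answer; case: dnf_decode => // X /(_ _ erefl) ->.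
case/andP=> kF sat; apply/hasP.
by exists (nth set0 (formula X) (inord (nat_of_bits p) : 'I_n.+1)) => //; apply: mem_nth.
Qed.

Lemma answer_proof_ok (J : n.-tuple bool) : dnf_answer c J -> exists p, proof_ok J p.
Proof.
rewrite /proof_ok /dnf_answer; case JX: dnf_decode => [X|//] /andP[_ /hasP[C CF sat]].
have kF : index C (formula X) < size (formula X) by rewrite index_mem.
have Fn : size (formula X) <= n by rewrite -(dnf_encoded_size JX) size_dnf_encode; lia.
have [|p pE] := @nat_of_bits_surj plen (index C (formula X)).
  exact: leq_trans kF (leq_trans Fn (up_logP _ _)).
exists p; rewrite pE inordK ?(leq_trans kF) ?(leqW Fn) // /clause_ok kF /=.
by rewrite nth_index.
Qed.

(** Updates exist only on narrow instances and leave the formula unchanged. *)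
Lemma narrow_last (I : n.-tuple bool) s X : s != [::] ->
  @instance_sequence (DNFdy c) n I s ->
  dnf_decode (last I (unzip2 s)) = Some X -> narrow c X.
Proof.
elim: s I => //= -[u J] s IH I _ [uJ sP] /=.
case: s IH sP => [_ _ /=|us s IH sP]; last exact: IH.
by have [X' [i [_ nX _ ->]]] := dnf_updP uJ => -[<-].
Qed.

End Membership.

Lemma zip_take_size (U T : Type) (us : seq U) (ps : seq T) :
  zip us ps = zip (take (size ps) us) ps.
Proof. by elim: ps us => [|p ps IH] [|u us] //=; rewrite -IH. Qed.

Lemma DNFdy_in_NPdy c : NPdy (DNFdy c).
Proof.
have wP : bounded_by (up_log 2) (clause_width c).
  by apply/polylog_boundedP; exists c.
have uP : bounded_by (up_log 2) dnf_upd_len := Theta_log_bounded dnf_upd_lenP.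
have iP : bounded_by (up_log 2) (fun n => dnf_upd_len n + up_log 2 n).
  exact: bounded_add uP (bounded_base _).
have timeP : bounded_by (up_log 2) (fun n => 1 + (2 * (clause_width c n).+1 + 0)).
  apply: bounded_add (bounded_const _ _) _; apply: bounded_add (bounded_const _ _).
  exact: bounded_mul (bounded_const _ _) (bounded_succ wP).
have idP : bounded_by id succn by apply: bounded_succ; apply: bounded_base.
have cellP : bounded_by id (fun n => #|cell (dnf_verifier c n)|).
  apply: (bounded_le (g := fun n => n.+1 * (clause_width c n).+1 + n.+1)).
    by move=> n; rewrite /= card_sum card_prod !card_ord.
  apply: (bounded_add _ idP); apply: (bounded_mul idP).
  exact/bounded_polylog/bounded_succ.
have wordP : bounded_by (up_log 2) (fun n => up_log 2 #|word (dnf_verifier c n)|).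
  apply: bounded_up_log_poly.
  apply: (bounded_le (g := fun n => (2 + n.+1 * 2).+1)).
    by move=> n; rewrite /= card_option card_sum card_prod card_ord !card_bool.
  apply/bounded_succ/bounded_add; first exact: bounded_const.
  exact: bounded_mul idP (bounded_const _ _).
exists (up_log 2), (fun _ => 1), (fun n => compiled (dnf_verifier c n)); split.
- by apply/polylog_boundedP; apply: bounded_base.
- by apply/polylog_boundedP; apply: bounded_const.
- exact: (@depth_family _ (fun=> 2) (dnf_verifier c) _ iP (bounded_const _ 2) timeP
    (@costs_verify_step c) wordP).
- exact: (@space_family _ (fun=> 2) (dnf_verifier c) iP (bounded_const _ 2) cellP wordP).
move=> n I s sP ps sz.
set V : verifier_family (DNFdy c) (up_log 2) (fun=> 1) :=
  fun n => compiled (dnf_verifier c n).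
have outE qs p : size qs < size s ->
    verifier_output V I (unzip1 s) (rcons qs p)
    = proof_out (last I (unzip2 (take (size qs).+1 s))) p.
  move=> qs_s; rewrite /verifier_output output_compiled zip_take_size size_rcons.
  rewrite /unzip1 -map_take word_run_verifier ?size_takel ?size_rcons //; last first.
    exact: instance_sequence_take.
  by case: qs {qs_s} => [|x qs] //=; rewrite last_rcons.
have verdict0 : verdict V I (unzip1 s) [::] = dnf_answer c I.
  rewrite /verdict /verifier_output output_compiled.
  by case: (unzip1 s) => [|? ?]; rewrite /word_run /= theadE.
have takeE t : t < size s -> exists p, take t.+1 ps = rcons (take t ps) p.
  by rewrite -sz; case: (ps) => // p0 qs ts; exists (nth p0 (p0 :: qs) t); rewrite -take_nth.
have verdictE t p : t < size s ->
    verdict V I (unzip1 s) (rcons (take t ps) p)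
    = proof_ok (last I (unzip2 (take t.+1 s))) p.
  by move=> ts; rewrite /verdict outE size_takel ?sz ?(ltnW ts) // theadE.
have rewardE t p : t < size s ->
    reward V I (unzip1 s) (rcons (take t ps) p)
    = proof_ok (last I (unzip2 (take t.+1 s))) p.
  by move=> ts; rewrite /reward outE size_takel ?sz ?(ltnW ts) //= addn0.
split=> [t ts|rm t ts]; rewrite nth_unzip2 //.
  (* At step 0 the verifier outputs the answer without a proof. *)
  case: t ts => [|t] ts; first by rewrite !take0 verdict0.
  have [p ->] := takeE t ts; rewrite verdictE // => ansF.
  apply/negbTE/negP=> /(@proof_ok_answer c) h; move: ansF; rewrite /= h // => X.
  by apply: narrow_last (instance_sequence_take _ sP); case: (s) ts.
case: t ts => [|t] ts; first by rewrite !take0 verdict0.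
move=> /answer_proof_ok[q qok]; have [p pE] := takeE t ts.
(* Maximality is compared with [q], whose reward is 1; hence the reward of [p], and with it the
   verdict, is 1. *)
have := rm t; rewrite sz => /(_ ts q); rewrite pE rewardE // rewardE // qok verdictE //.
by case: proof_ok.
Qed.

Theorem mainTheorem2 (c : nat) (c_gt0 : 0 < c) :
  NPdy (DNFdy c) /\
  (Pdy (DNFdy c) -> forall D : dynamic_problem, NPdy D -> Pdy D).
Proof.
split; first exact: DNFdy_in_NPdy.
move=> [A [A_depth A_space A_solves]] D [plen [rlen [V [plenP rlenP V_depth V_space VP]]]].
exact: (NPdy_in_Pdy c_gt0 A_solves A_depth A_space plenP rlenP V_depth V_space VP).
Qed.
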